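(* Let $H=(\{H_\alpha\},\Delta,\epsilon,S,\varphi,R,\theta)$ be a ribbon Hopf $\pi$-coalgebra with Drinfeld elements $u_\alpha$, and set $G_\alpha=\theta_\alpha u_\alpha=u_\alpha\theta_\alpha\in H_\alpha$ for $\alpha\in\pi$. Then: (a) $G=(G_\alpha)_{\alpha\in\pi}$ is a $\pi$-grouplike element of $H$; (b) $\varphi_\beta(G_\alpha)=G_{\beta\alpha\beta^{-1}}$ for all $\alpha,\beta\in\pi$; (c) $S_\alpha(G_\alpha)=G_{\alpha^{-1}}^{-1}$ for all $\alpha\in\pi$; (d) $\theta_\alpha^{-2}=c_\alpha$ for all $\alpha\in\pi$, where $c_\alpha=S_{\alpha^{-1}}(u_{\alpha^{-1}})u_\alpha=u_\alpha S_{\alpha^{-1}}(u_{\alpha^{-1}})$; (e) $S_\alpha(u_\alpha)=G_{\alpha^{-1}}^{-1}u_{\alpha^{-1}}G_{\alpha^{-1}}^{-1}$ for all $\alpha\in\pi$; (f) $S_{\alpha^{-1}}S_\alpha(x)=G_\alpha xG_\alpha^{-1}$ for all $\alpha\in\pi$ and $x\in H_\alpha$.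
   Context: Throughout, $\pi$ is a discrete group with neutral element $1$, $\Bbbk$ is a field, $\otimes=\otimes_\Bbbk$, and algebras are associative and unital over $\Bbbk$ (the zero algebra is allowed). A $\pi$-coalgebra is a family $C=\{C_\alpha\}_{\alpha\in\pi}$ of $\Bbbk$-spaces with $\Bbbk$-linear maps $\Delta_{\alpha,\beta}:C_{\alpha\beta}\to C_\alpha\otimes C_\beta$ and $\epsilon:C_1\to\Bbbk$ such that $(\Delta_{\alpha,\beta}\otimes\mathrm{id}_{C_\gamma})\Delta_{\alpha\beta,\gamma}=(\mathrm{id}_{C_\alpha}\otimes\Delta_{\beta,\gamma})\Delta_{\alpha,\beta\gamma}$ and $(\mathrm{id}_{C_\alpha}\otimes\epsilon)\Delta_{\alpha,1}=\mathrm{id}_{C_\alpha}=(\epsilon\otimes\mathrm{id}_{C_\alpha})\Delta_{1,\alpha}$ for all $\alpha,\beta,\gamma\in\pi$. A Hopf $\pi$-coalgebra is a $\pi$-coalgebra $H=(\{H_\alpha\},\Delta,\epsilon)$ with $\Bbbk$-linear maps $S_\alpha:H_\alpha\to H_{\alpha^{-1}}$ such that each $H_\alpha$ is an algebra with multiplication $m_\alpha$ and unit $1_\alpha$, the maps $\epsilon$ and all $\Delta_{\alpha,\beta}$ are algebra homomorphisms, and $m_\alpha(S_{\alpha^{-1}}\otimes\mathrm{id}_{H_\alpha})\Delta_{\alpha^{-1},\alpha}=\epsilon 1_\alpha=m_\alpha(\mathrm{id}_{H_\alpha}\otimes S_{\alpha^{-1}})\Delta_{\alpha,\alpha^{-1}}$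 for all $\alpha$. A crossed Hopf $\pi$-coalgebra is one endowed with a crossing: $\Bbbk$-linear maps $\varphi_\beta:H_\alpha\to H_{\beta\alpha\beta^{-1}}$ ($\alpha,\beta\in\pi$) that are algebra isomorphisms with $(\varphi_\beta\otimes\varphi_\beta)\Delta_{\alpha,\gamma}=\Delta_{\beta\alpha\beta^{-1},\beta\gamma\beta^{-1}}\varphi_\beta$, $\epsilon\varphi_\beta=\epsilon$, and $\varphi_{\beta\beta'}=\varphi_\beta\varphi_{\beta'}$. Let $\sigma_{\beta,\alpha}:H_\beta\otimes H_\alpha\to H_\alpha\otimes H_\beta$ be the flip. A quasitriangular Hopf $\pi$-coalgebra is a crossed one with invertible elements $R_{\alpha,\beta}\in H_\alpha\otimes H_\beta$ ($\alpha,\beta\in\pi$) such that for all $\alpha,\beta,\gamma\in\pi$: (i) $R_{\alpha,\beta}\cdot\Delta_{\alpha,\beta}(x)=\sigma_{\beta,\alpha}(\varphi_{\alpha^{-1}}\otimes\mathrm{id}_{H_\alpha})\Delta_{\alpha\beta\alpha^{-1},\alpha}(x)\cdot R_{\alpha,\beta}$ for all $x\in H_{\alpha\beta}$; (ii) $(\mathrm{id}_{H_\alpha}\otimes\Delta_{\beta,\gamma})(R_{\alpha,\beta\gamma})=(R_{\alpha,\gamma})_{1\beta3}\cdot(R_{\alpha,\beta})_{12\gamma}$ and $(\Delta_{\alpha,\beta}\otimes\mathrm{id}_{H_\gamma})(R_{\alpha\beta,\gamma})=[(\mathrm{id}_{H_\alpha}\otimes\varphi_{\beta^{-1}})(R_{\alpha,\beta\gamma\beta^{-1}})]_{1\beta3}\cdot(R_{\beta,\gamma})_{\alpha23}$,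 where for $r=\sum_jp_j\otimes q_j$ one sets $r_{12\gamma}=r\otimes1_\gamma$, $r_{\alpha23}=1_\alpha\otimes r$, $r_{1\beta3}=\sum_jp_j\otimes1_\beta\otimes q_j$; (iii) $(\varphi_\beta\otimes\varphi_\beta)(R_{\alpha,\gamma})=R_{\beta\alpha\beta^{-1},\beta\gamma\beta^{-1}}$. Its Drinfeld elements are $u_\alpha=m_\alpha(S_{\alpha^{-1}}\varphi_\alpha\otimes\mathrm{id}_{H_\alpha})\sigma_{\alpha,\alpha^{-1}}(R_{\alpha,\alpha^{-1}})\in H_\alpha$; they are invertible, commute with $\theta_\alpha$ in the ribbon case, and satisfy $S_{\alpha^{-1}}(u_{\alpha^{-1}})u_\alpha=u_\alpha S_{\alpha^{-1}}(u_{\alpha^{-1}})$. A ribbon Hopf $\pi$-coalgebra is a quasitriangular one with invertible elements $\theta_\alpha\in H_\alpha$ (the twist) such that for all $\alpha,\beta$: $\varphi_\alpha(x)=\theta_\alpha^{-1}x\theta_\alpha$ for $x\in H_\alpha$; $S_\alpha(\theta_\alpha)=\theta_{\alpha^{-1}}$; $\varphi_\beta(\theta_\alpha)=\theta_{\beta\alpha\beta^{-1}}$; $\Delta_{\alpha,\beta}(\theta_{\alpha\beta})=(\theta_\alpha\otimes\theta_\beta)\cdot\sigma_{\beta,\alpha}((\varphi_{\alpha^{-1}}\otimes\mathrm{id}_{H_\alpha})(R_{\alpha\beta\alpha^{-1},\alpha}))\cdot R_{\alpha,\beta}$. A $\pi$-grouplike element of $H$ is a family $g=(g_\alpha)\in\prod_\alpha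 H_\alpha$ with $\Delta_{\alpha,\beta}(g_{\alpha\beta})=g_\alpha\otimes g_\beta$ for all $\alpha,\beta$ and $\epsilon(g_1)=1$. *)

(* Defs.v *)
(* Classical logic is used only to turn the Prop-valued congruence defining
   tensors into a boolean one and to choose inverses. *)
From HB Require Import structures.
From mathcomp Require Import all_boot all_algebra.
From mathcomp Require Import boolp classical_sets.

Set Implicit Arguments.
Unset Strict Implicit.
Unset Printing Implicit Defensive.

Import GRing.Theory.
Local Open Scope ring_scope.
Local Open Scope quotient_scope.

(* MathComp's algType excludes the zero ring; this is the same structure over
   a possibly zero ring. The ring axioms are repeated in the mixin because the
   hierarchy does not admit a new join of Lmodule and PzRing; the PzRing
   structure is recovered just below. *)
HB.mixin Record Lmodule_isPzAlgebra (k : fieldType) A of GRing.Lmodule k A := {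
  pzalg_one : A;
  pzalg_mul : A -> A -> A;
  pzalg_mulA : associative pzalg_mul;
  pzalg_mul1 : left_id pzalg_one pzalg_mul;
  pzalg_mulr1 : right_id pzalg_one pzalg_mul;
  pzalg_mulDl : left_distributive pzalg_mul +%R;
  pzalg_mulDr : right_distributive pzalg_mul +%R;
  pzalg_scaleAl : forall (c : k) (x y : A),
    c *: pzalg_mul x y = pzalg_mul (c *: x) y;
  pzalg_scaleAr : forall (c : k) (x y : A),
    c *: pzalg_mul x y = pzalg_mul x (c *: y)
}.

#[short(type="pzAlgType")]
HB.structure Definition PzAlgebra (k : fieldType) :=
  { A of GRing.Lmodule k A & Lmodule_isPzAlgebra k A }.

HB.instance Definition _ (k : fieldType) (A : pzAlgType k) :=
  GRing.Zmodule_isPzRing.Build (PzAlgebra.sort A)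
    pzalg_mulA pzalg_mul1 pzalg_mulr1 pzalg_mulDl pzalg_mulDr.

Lemma pzscalerAl (k : fieldType) (A : pzAlgType k) (c : k) (x y : A) :
  c *: (x * y) = (c *: x) * y.
Proof. exact: pzalg_scaleAl. Qed.

Lemma pzscalerAr (k : fieldType) (A : pzAlgType k) (c : k) (x y : A) :
  c *: (x * y) = x * (c *: y).
Proof. exact: pzalg_scaleAr. Qed.

Section Inverses.
Variable A : pzRingType.
Implicit Types x y : A.

Definition is_inverse x y : Prop := x * y = 1 /\ y * x = 1.

Definition invertible x : Prop := exists y, is_inverse x y.

(* As for MathComp's inverse, the value at a non-invertible x is x itself. *)
Definition pzinv x : A := xget x (is_inverse x).

Lemma pzinvP x : invertible x -> is_inverse x (pzinv x).
Proof. exact: xgetPex. Qed.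

Lemma pzinv_unique x y : is_inverse x y -> pzinv x = y.
Proof.
move=> ixy; apply: xget_unique => // z [_ zx].
by rewrite -[z]mulr1 -ixy.1 mulrA zx mul1r.
Qed.

End Inverses.

Section Tensor.
Variables (k : fieldType) (V W : lmodType k).

(* A formal sum of pure tensors is a sequence of pairs, so that concatenation
   is addition and the empty sequence is zero. No coefficients are needed,
   since scalars are absorbed in the first factor. *)
Inductive tcongr : seq (V * W) -> seq (V * W) -> Prop :=
| tcongr_refl s : tcongr s s
| tcongr_sym s t : tcongr s t -> tcongr t s
| tcongr_trans s t r : tcongr s t -> tcongr t r -> tcongr s r
| tcongr_cat s s' t t' :
    tcongr s s' -> tcongr t t' -> tcongr (s ++ t) (s' ++ t')
| tcongr_comm s t : tcongr (s ++ t) (t ++ s)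
| tcongr_zero w : tcongr [:: (0, w)] [::]
| tcongr_addl v v' w : tcongr [:: (v + v', w)] [:: (v, w); (v', w)]
| tcongr_addr v w w' : tcongr [:: (v, w + w')] [:: (v, w); (v, w')]
| tcongr_scale c v w : tcongr [:: (c *: v, w)] [:: (v, c *: w)].

Definition tcongrb : rel (seq (V * W)) := fun s t => `[< tcongr s t >].

Lemma tcongrb_refl : reflexive tcongrb.
Proof. by move=> s; apply/asboolP; constructor. Qed.

Lemma tcongrb_sym : symmetric tcongrb.
Proof.
by move=> s t; apply/asboolP/asboolP => h; apply: tcongr_sym.
Qed.

Lemma tcongrb_trans : transitive tcongrb.
Proof.
move=> t s r /asboolP st /asboolP tr.
by apply/asboolP; apply: tcongr_trans st tr.
Qed.

Canonical tcongr_equiv :=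
  EquivRel tcongrb tcongrb_refl tcongrb_sym tcongrb_trans.

Definition tens : Type := {eq_quot tcongr_equiv}.

HB.instance Definition _ := Choice.on tens.
HB.instance Definition _ := EqQuotient.on tens.

Lemma tens_piW (P : tens -> Prop) : (forall s, P (\pi_tens s)) -> forall x, P x.
Proof. by move=> Ps x; rewrite -[x]reprK; apply: Ps. Qed.

Lemma tens_eqP s t : (\pi_tens s = \pi_tens t) <-> tcongr s t.
Proof.
split; first by move=> /eqmodP /asboolP.
by move=> st; apply/eqmodP/asboolP.
Qed.

Lemma tens_reprP s : tcongr (repr (\pi_tens s)) s.
Proof. by apply/tens_eqP; rewrite reprK. Qed.

Definition tzero : tens := \pi_tens [::].
Definition tadd (x y : tens) : tens := \pi_tens (repr x ++ repr y).
Definition sscale (c : k) (s : seq (V * W)) : seq (V * W) :=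
  [seq (c *: p.1, p.2) | p <- s].
Definition tscale (c : k) (x : tens) : tens := \pi_tens (sscale c (repr x)).
Definition topp (x : tens) : tens := tscale (- 1) x.

Lemma tadd_pi s t : tadd (\pi_tens s) (\pi_tens t) = \pi_tens (s ++ t).
Proof. by apply/tens_eqP; apply: tcongr_cat; apply: tens_reprP. Qed.

Lemma sscale_tcongr c s t : tcongr s t -> tcongr (sscale c s) (sscale c t).
Proof.
elim=> {s t}.
- by move=> s; apply: tcongr_refl.
- by move=> s t _; apply: tcongr_sym.
- by move=> s t r _ st _; apply: tcongr_trans st.
- by move=> s s' t t' _ ? _ ?; rewrite /sscale !map_cat; apply: tcongr_cat.
- by move=> s t; rewrite /sscale !map_cat; apply: tcongr_comm.
- by move=> w /=; rewrite scaler0; apply: tcongr_zero.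
- by move=> v v' w /=; rewrite scalerDr; apply: tcongr_addl.
- by move=> v w w' /=; apply: tcongr_addr.
- move=> d v w /=; rewrite scalerA mulrC -scalerA; exact: tcongr_scale.
Qed.

Lemma tscale_pi c s : tscale c (\pi_tens s) = \pi_tens (sscale c s).
Proof. by apply/tens_eqP; apply: sscale_tcongr; apply: tens_reprP. Qed.

Lemma taddA : associative tadd.
Proof.
move=> x y z; elim/tens_piW: x => s; elim/tens_piW: y => t; elim/tens_piW: z => r.
by rewrite !tadd_pi catA.
Qed.

Lemma taddC : commutative tadd.
Proof.
move=> x y; elim/tens_piW: x => s; elim/tens_piW: y => t; rewrite !tadd_pi.
by apply/tens_eqP; apply: tcongr_comm.
Qed.

Lemma tadd0 : left_id tzero tadd.
Proof. by move=> x; elim/tens_piW: x => s; rewrite tadd_pi. Qed.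

Lemma tcongr_scaleDl a b s :
  tcongr (sscale (a + b) s) (sscale a s ++ sscale b s).
Proof.
elim: s => [|[v w] s IHs] /=; first exact: tcongr_refl.
rewrite scalerDl -cat1s.
apply: tcongr_trans (tcongr_cat (tcongr_addl _ _ _) IHs) _.
apply: (@tcongr_cat [:: (a *: v, w)] [:: (a *: v, w)]
  ([:: (b *: v, w)] ++ (sscale a s ++ sscale b s))
  (sscale a s ++ ([:: (b *: v, w)] ++ sscale b s))).
  exact: tcongr_refl.
rewrite !catA; apply: tcongr_cat; last exact: tcongr_refl.
exact: tcongr_comm.
Qed.

Lemma tscaleDl x : {morph tscale^~ x : a b / a + b >-> tadd a b}.
Proof.
elim/tens_piW: x => s a b; rewrite !tscale_pi tadd_pi.
by apply/tens_eqP; apply: tcongr_scaleDl.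
Qed.

Lemma sscale0 s : tcongr (sscale 0 s) [::].
Proof.
elim: s => [|[v w] s IHs] /=; first exact: tcongr_refl.
rewrite scale0r -cat1s -[X in tcongr _ X]cats0.
by apply: tcongr_cat IHs; apply: tcongr_zero.
Qed.

Lemma tscale1 : left_id 1 tscale.
Proof.
move=> x; elim/tens_piW: x => s; rewrite tscale_pi; congr (\pi_tens _).
by rewrite /sscale -[RHS]map_id; apply: eq_map => -[v w]; rewrite /= scale1r.
Qed.

Lemma taddN : left_inverse tzero topp tadd.
Proof.
move=> x; elim/tens_piW: x => s; rewrite /topp -[X in tadd _ X]tscale1 -tscaleDl addNr.
by rewrite tscale_pi; apply/tens_eqP; apply: sscale0.
Qed.

HB.instance Definition _ := GRing.isZmodule.Build tens taddA taddC tadd0 taddN.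

Lemma tscaleA a b x : tscale a (tscale b x) = tscale (a * b) x.
Proof.
elim/tens_piW: x => s; rewrite !tscale_pi; congr (\pi_tens _).
by rewrite /sscale -map_comp; apply: eq_map => -[v w] /=; rewrite scalerA.
Qed.

Lemma tscaleDr : right_distributive tscale +%R.
Proof.
move=> a x y; elim/tens_piW: x => s; elim/tens_piW: y => t; rewrite /GRing.add /=.
by rewrite tadd_pi !tscale_pi tadd_pi /sscale map_cat.
Qed.

HB.instance Definition _ := GRing.Zmodule_isLmodule.Build k tens
  tscaleA tscale1 tscaleDr tscaleDl.

Definition tpure (v : V) (w : W) : tens := \pi_tens [:: (v, w)].

Lemma tpure_bilinear : bilinear_for *:%R *:%R tpure.
Proof.
split=> [w c v v'|v c w w'] /=; rewrite /GRing.add /GRing.scale /= tscale_pi.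
  by rewrite tadd_pi /=; apply/tens_eqP; apply: tcongr_addl.
rewrite tadd_pi /=; apply/tens_eqP; apply: tcongr_trans (tcongr_addr _ _ _) _.
rewrite -cat1s -[X in tcongr _ X]cat1s; apply: tcongr_cat.
  by apply: tcongr_sym; apply: tcongr_scale.
exact: tcongr_refl.
Qed.

Lemma tens_pi_sum s : \pi_tens s = \sum_(p <- s) tpure p.1 p.2.
Proof.
elim: s => [|[v w] s IHs]; first by rewrite big_nil.
by rewrite big_cons -IHs /GRing.add /= tadd_pi.
Qed.

Lemma tensE x : x = \sum_(p <- repr x) tpure p.1 p.2.
Proof. by rewrite -tens_pi_sum reprK. Qed.

(* The linear map determined by a bilinear map f; tliftE is its defining
   property. For an f that is not bilinear the value is meaningless. *)
Definition tlift (U : lmodType k) (f : V -> W -> U) (x : tens) : U :=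
  \sum_(p <- repr x) f p.1 p.2.

Lemma tlift_pi (U : lmodType k) (f : V -> W -> U) s :
  bilinear_for *:%R *:%R f -> tlift f (\pi_tens s) = \sum_(p <- s) f p.1 p.2.
Proof.
move=> [fl fr]; rewrite /tlift.
have fDl v v' w : f (v + v') w = f v w + f v' w.
  by have /= := fl w 1 v v'; rewrite !scale1r.
have fDr v w w' : f v (w + w') = f v w + f v w'.
  by have /= := fr v 1 w w'; rewrite !scale1r.
have f0l w : f 0 w = 0.
  by apply: (addrI (f 0 w)); rewrite -fDl !addr0.
have f0r v : f v 0 = 0.
  by apply: (addrI (f v 0)); rewrite -fDr !addr0.
have fZl c v w : f (c *: v) w = c *: f v w.
  by have /= := fl w c v 0; rewrite !addr0 f0l addr0.
have fZr c v w : f v (c *: w) = c *: f v w.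
  by have /= := fr v c w 0; rewrite !addr0 f0r addr0.
suff f_congr t r : tcongr t r ->
    \sum_(p <- t) f p.1 p.2 = \sum_(p <- r) f p.1 p.2.
  exact/f_congr/tens_reprP.
elim=> // {s t r}.
- by move=> s t r _ -> _ ->.
- by move=> s s' t t' _ e _ e'; rewrite !big_cat /= e e'.
- by move=> s t; rewrite !big_cat /= addrC.
- by move=> w; rewrite big_cons big_nil f0l addr0.
- by move=> v v' w; rewrite !big_cons !big_nil !addr0 fDl.
- by move=> v w w'; rewrite !big_cons !big_nil !addr0 fDr.
- by move=> c v w; rewrite !big_cons !big_nil !addr0 fZl fZr.
Qed.

Lemma tliftE (U : lmodType k) (f : V -> W -> U) v w :
  bilinear_for *:%R *:%R f -> tlift f (tpure v w) = f v w.
Proof. by move=> fB; rewrite tlift_pi // big_cons big_nil addr0. Qed.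

Lemma tlift_linear (U : lmodType k) (f : V -> W -> U) :
  bilinear_for *:%R *:%R f -> linear (tlift f).
Proof.
move=> fB c x y; elim/tens_piW: x => s; elim/tens_piW: y => t.
rewrite [X in X + _]/GRing.scale /= tscale_pi /GRing.add /= tadd_pi.
rewrite !tlift_pi // big_cat scaler_sumr big_map; congr (_ + _).
apply: eq_bigr => -[v w] _ /=; case: fB => fl _.
have f0 : f 0 w = 0.
  have /= := fl w 1 0 0; rewrite !scale1r addr0.
  by move=> /(congr1 (fun x => x - f 0 w)); rewrite addrK subrr.
by have /= := fl w c v 0; rewrite !addr0 f0 addr0.
Qed.

Lemma tens_ind (P : tens -> Prop) :
  P 0 -> (forall v w x, P x -> P (tpure v w + x)) -> forall x, P x.
Proof.
move=> P0 PD x; rewrite [x]tensE.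
by elim: (repr x) => [|p s IHs]; rewrite ?big_nil ?big_cons; auto.
Qed.

Lemma eq_tens_linear (U : lmodType k) (f g : tens -> U) :
  linear f -> linear g ->
  (forall v w, f (tpure v w) = g (tpure v w)) -> f =1 g.
Proof.
move=> fL gL fg.
have D (h : tens -> U) : linear h -> forall x y, h (x + y) = h x + h y.
  by move=> hL x y; have := hL 1 x y; rewrite !scale1r.
have Z (h : tens -> U) : linear h -> h 0 = 0.
  by move=> hL; have e := D h hL 0 0; apply: (addrI (h 0)); rewrite -e !addr0.
move=> x; elim/tens_ind: x => [|v w x IHx]; first by rewrite !Z.
by rewrite !D // fg IHx.
Qed.

End Tensor.

Notation "v ⊗ w" := (tpure v w) (at level 40, left associativity) : ring_scope.

Arguments tens {k} V W.

Section TensorMaps.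
Variable k : fieldType.
Implicit Types U V W : lmodType k.

(* f ⊗ g, for linear f and g. *)
Definition tmap V W V' W' (f : V -> V') (g : W -> W') : tens V W -> tens V' W' :=
  tlift (fun v w => f v ⊗ g w).

Definition tflip V W : tens V W -> tens W V := tlift (fun v w => w ⊗ v).

Definition tassoc U V W : tens (tens U V) W -> tens U (tens V W) :=
  tlift (fun t w => tmap idfun (fun v => v ⊗ w) t).

Definition tunitr V : tens V k^o -> V := tlift (fun (v : V) (c : k^o) => c *: v).
Definition tunitl V : tens k^o V -> V := tlift (fun (c : k^o) (v : V) => c *: v).

Lemma tpureDl V W (v v' : V) (w : W) : (v + v') ⊗ w = v ⊗ w + v' ⊗ w.
Proof. by have /= := (tpure_bilinear V W).1 w 1 v v'; rewrite !scale1r. Qed.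

Lemma tpureDr V W (v : V) (w w' : W) : v ⊗ (w + w') = v ⊗ w + v ⊗ w'.
Proof. by have /= := (tpure_bilinear V W).2 v 1 w w'; rewrite !scale1r. Qed.

Lemma tpure0l V W (w : W) : (0 : V) ⊗ w = 0.
Proof. by apply: (addrI (0 ⊗ w)); rewrite -tpureDl !addr0. Qed.

Lemma tpure0r V W (v : V) : v ⊗ (0 : W) = 0.
Proof. by apply: (addrI (v ⊗ 0)); rewrite -tpureDr !addr0. Qed.

Lemma tpureZl V W c (v : V) (w : W) : (c *: v) ⊗ w = c *: (v ⊗ w).
Proof.
by have /= := (tpure_bilinear V W).1 w c v 0; rewrite !addr0 tpure0l addr0.
Qed.

Lemma tpureZr V W c (v : V) (w : W) : v ⊗ (c *: w) = c *: (v ⊗ w).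
Proof.
by have /= := (tpure_bilinear V W).2 v c w 0; rewrite !addr0 tpure0r addr0.
Qed.

Lemma tmap_bilinear V W V' W' (f : V -> V') (g : W -> W') :
  linear f -> linear g -> bilinear_for *:%R *:%R (fun v w => f v ⊗ g w).
Proof.
move=> fL gL; split=> [w c v v'|v c w w'] /=.
  by rewrite fL tpureDl tpureZl.
by rewrite gL tpureDr tpureZr.
Qed.

Lemma tmapE V W V' W' (f : V -> V') (g : W -> W') v w :
  linear f -> linear g -> tmap f g (v ⊗ w) = f v ⊗ g w.
Proof. by move=> fL gL; rewrite /tmap tliftE //; apply: tmap_bilinear. Qed.

Lemma tmap_linear V W V' W' (f : V -> V') (g : W -> W') :
  linear f -> linear g -> linear (tmap f g).
Proof. by move=> fL gL; apply: tlift_linear; apply: tmap_bilinear. Qed.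

Lemma tflip_bilinear V W : bilinear_for *:%R *:%R (fun (v : V) (w : W) => w ⊗ v).
Proof.
by split=> [w c v v'|v c w w'] /=; rewrite ?tpureDl ?tpureZl ?tpureDr ?tpureZr.
Qed.

Lemma tflipE V W (v : V) (w : W) : tflip (v ⊗ w) = w ⊗ v.
Proof. by rewrite /tflip tliftE //; apply: tflip_bilinear. Qed.

Lemma tassoc_bilinear U V W : bilinear_for *:%R *:%R
  (fun (t : tens U V) (w : W) => tmap idfun (fun v : V => v ⊗ w) t).
Proof.
split=> [w|t c w w'] /=.
  by apply: tmap_linear => // c v v'; rewrite tpureDl tpureZl.
rewrite /tmap /tlift scaler_sumr -big_split /=; apply: eq_bigr => p _.
by rewrite tpureDr tpureZr tpureDr tpureZr.
Qed.

Lemma tassocE U V W (u : U) (v : V) (w : W) :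
  tassoc (u ⊗ v ⊗ w) = u ⊗ (v ⊗ w).
Proof.
rewrite /tassoc tliftE; last exact: tassoc_bilinear.
by rewrite tmapE // => c x y; rewrite tpureDl tpureZl.
Qed.

Lemma tunitrE V (v : V) (c : k^o) : tunitr (v ⊗ c) = c *: v.
Proof.
rewrite /tunitr tliftE //; split=> [d a x y|x a d e] /=.
  by rewrite scalerDr !scalerA mulrC.
by rewrite scalerDl scalerA.
Qed.

Lemma tunitlE V (v : V) (c : k^o) : tunitl (c ⊗ v) = c *: v.
Proof.
rewrite /tunitl tliftE //; split=> [x a d e|d a x y] /=.
  by rewrite scalerDl scalerA.
by rewrite scalerDr !scalerA mulrC.
Qed.

End TensorMaps.

Section TensorAlgebra.
Variables (k : fieldType) (A B : pzAlgType k).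

Definition tone : tens A B := (1 : A) ⊗ (1 : B).

(* The bilinear extension of (a ⊗ b)(a' ⊗ b') = aa' ⊗ bb'. *)
Definition tmul (x y : tens A B) : tens A B :=
  tlift (fun (a : A) (b : B) => tmap ( *%R a) ( *%R b) y) x.

Lemma mull_linear (C : pzAlgType k) (a : C) : linear ( *%R a).
Proof. by move=> c x y; rewrite mulrDr pzscalerAr. Qed.

Lemma tmul_bilinear (y : tens A B) :
  bilinear_for *:%R *:%R (fun (a : A) (b : B) => tmap ( *%R a) ( *%R b) y).
Proof.
rewrite /tmap /tlift; split=> [b c a a'|a c b b'] /=.
  rewrite scaler_sumr -big_split; apply: eq_bigr => p _ /=.
  by rewrite mulrDl tpureDl -pzscalerAl tpureZl.
rewrite scaler_sumr -big_split; apply: eq_bigr => p _ /=.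
by rewrite mulrDl tpureDr -pzscalerAl tpureZr.
Qed.

Lemma tmul_pure (a a' : A) (b b' : B) : tmul (a ⊗ b) (a' ⊗ b') = (a * a') ⊗ (b * b').
Proof.
rewrite /tmul tliftE; last exact: tmul_bilinear.
by rewrite tmapE //; apply: mull_linear.
Qed.

Lemma tmul_linearl y : linear (tmul^~ y).
Proof. exact/tlift_linear/tmul_bilinear. Qed.

Lemma tmul_linearr x : linear (tmul x).
Proof.
move=> c y y'; rewrite /tmul /tlift scaler_sumr -big_split.
apply: eq_bigr => p _ /=.
exact: (tmap_linear (@mull_linear A p.1) (@mull_linear B p.2)).
Qed.

Lemma tmulDl : left_distributive tmul +%R.
Proof. by move=> x y z; have /= := tmul_linearl z 1 x y; rewrite !scale1r. Qed.

Lemma tmulDr : right_distributive tmul +%R.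
Proof. by move=> x y z; have := tmul_linearr x 1 y z; rewrite !scale1r. Qed.

Lemma tmul0l x : tmul 0 x = 0.
Proof. by apply: (addrI (tmul 0 x)); rewrite -tmulDl !addr0. Qed.

Lemma tmul0r x : tmul x 0 = 0.
Proof. by apply: (addrI (tmul x 0)); rewrite -tmulDr !addr0. Qed.

Lemma tmulZl c x y : c *: tmul x y = tmul (c *: x) y.
Proof.
by have /= := tmul_linearl y c x 0; rewrite !addr0 tmul0l addr0 => ->.
Qed.

Lemma tmulZr c x y : c *: tmul x y = tmul x (c *: y).
Proof.
by have := tmul_linearr x c y 0; rewrite !addr0 tmul0r addr0 => ->.
Qed.

Lemma tmulA : associative tmul.
Proof.
move=> x y z; elim/tens_ind: x => [|a b x IHx]; first by rewrite !tmul0l.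
rewrite !tmulDl -IHx; congr (_ + _); clear x IHx.
elim/tens_ind: y => [|a' b' y IHy]; first by rewrite !(tmul0l, tmul0r).
rewrite !(tmulDl, tmulDr) IHy; congr (_ + _); clear y IHy.
elim/tens_ind: z => [|a2 b2 z IHz]; first by rewrite !tmul0r.
by rewrite !tmulDr IHz !tmul_pure !mulrA.
Qed.

Lemma tmul1 : left_id tone tmul.
Proof.
move=> x; elim/tens_ind: x => [|a b x IHx]; first by rewrite tmul0r.
by rewrite tmulDr IHx tmul_pure !mul1r.
Qed.

Lemma tmulr1 : right_id tone tmul.
Proof.
move=> x; elim/tens_ind: x => [|a b x IHx]; first by rewrite tmul0l.
by rewrite tmulDl IHx tmul_pure !mulr1.
Qed.

HB.instance Definition _ := GRing.Zmodule_isPzRing.Build (tens A B)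
  tmulA tmul1 tmulr1 tmulDl tmulDr.
HB.instance Definition _ := Lmodule_isPzAlgebra.Build k (tens A B)
  tmulA tmul1 tmulr1 tmulDl tmulDr tmulZl tmulZr.

Lemma tpureM (a a' : A) (b b' : B) : (a ⊗ b) * (a' ⊗ b') = (a * a') ⊗ (b * b').
Proof. exact: tmul_pure. Qed.

End TensorAlgebra.

(* The multiplication of A as a linear map on A ⊗ A. *)
Definition tmult (k : fieldType) (A : pzAlgType k) : tens A A -> A :=
  tlift (fun a b : A => a * b).

Lemma tmultE (k : fieldType) (A : pzAlgType k) (a b : A) :
  tmult (a ⊗ b) = a * b.
Proof.
rewrite /tmult tliftE //; split=> [y c x x'|x c y y'] /=.
  by rewrite mulrDl pzscalerAl.
by rewrite mulrDr pzscalerAr.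
Qed.

(* The embeddings r_{12C}, r_{A23}, r_{1B3} into A ⊗ (B ⊗ C); threefold
   tensor products are always bracketed to the right. *)
Definition leg12 (k : fieldType) (A B C : pzAlgType k) (r : tens A B) :
  tens A (tens B C) := tassoc (r ⊗ (1 : C)).
Definition leg23 (k : fieldType) (A B C : pzAlgType k) (r : tens B C) :
  tens A (tens B C) := (1 : A) ⊗ r.
Definition leg13 (k : fieldType) (A B C : pzAlgType k) (r : tens A C) :
  tens A (tens B C) := tmap idfun (fun q => (1 : B) ⊗ q) r.
Arguments leg12 {k A B} C r.
Arguments leg23 {k} A {B C} r.
Arguments leg13 {k A} B {C} r.

(* The identification of F a with F b along an equality of indices. *)
Definition icast (I : Type) (F : I -> Type) (a b : I) (e : a = b) : F a -> F b :=
  fun x => ecast i (F i) e x.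
Arguments icast {I} F {a b} e _.

Section GroupIdentities.
Local Open Scope group_scope.
Variable G : groupType.
Implicit Types a b c : G.

(* Left conjugation; MathComp's a ^ b is the right one, b^-1 a b. *)
Definition lconj b a := b * a * b^-1.

Lemma lconjM b a c : lconj b (a * c) = lconj b a * lconj b c.
Proof. by rewrite /lconj !mulgA mulgVK. Qed.

Lemma lconj1 b : lconj b 1 = 1.
Proof. by rewrite /lconj mulg1 mulgV. Qed.

Lemma lconj_comp b c a : lconj b (lconj c a) = lconj (b * c) a.
Proof. by rewrite /lconj invgM !mulgA. Qed.

Lemma lconjK b a : lconj b^-1 (lconj b a) = a.
Proof. by rewrite lconj_comp mulVg /lconj invg1 mul1g mulg1. Qed.

Lemma lconj_id a : lconj a a = a.
Proof. by rewrite /lconj mulgK. Qed.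

Lemma lconjV a : lconj a a^-1 = a^-1.
Proof. by rewrite /lconj mulgV mul1g. Qed.

Lemma lconjMr a b : lconj a b * a = a * b.
Proof. by rewrite /lconj mulgVK. Qed.

End GroupIdentities.

Section HopfPiCoalgebras.
Variables (k : fieldType) (pi : groupType).
Implicit Types a b c : pi.

Record pi_coalgebra (C : pi -> lmodType k) := PiCoalgebra {
  Delta : forall a b, {linear C (a * b)%g -> tens (C a) (C b)};
  eps : {linear C 1%g -> k^o};
  Delta_coassoc : forall a b c (x : C (a * b * c)%g),
    tassoc (tmap (Delta a b) idfun (Delta (a * b)%g c x)) =
    tmap idfun (Delta b c) (Delta a (b * c)%g (icast C (esym (mulgA a b c)) x));
  Delta_counitr : forall a (x : C a),
    tunitr (tmap idfun eps (Delta a 1%g (icast C (esym (mulg1 a)) x))) = x;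
  Delta_counitl : forall a (x : C a),
    tunitl (tmap eps idfun (Delta 1%g a (icast C (esym (mul1g a)) x))) = x
}.

Record hopf_pi_coalgebra := HopfPiCoalgebra {
  hcarrier :> pi -> pzAlgType k;
  hcoalg : pi_coalgebra (fun a => hcarrier a : lmodType k);
  antip : forall a, {linear hcarrier a -> hcarrier a^-1%g};
  eps_hom : GRing.monoid_morphism (eps hcoalg);
  Delta_hom : forall a b, GRing.monoid_morphism (Delta hcoalg a b);
  antipl : forall a (x : hcarrier 1%g),
    tmult (tmap (icast hcarrier (invgK a) \o antip a^-1%g) idfun
      (Delta hcoalg a^-1%g a (icast hcarrier (esym (mulVg a)) x))) =
    (eps hcoalg x : k) *: (1 : hcarrier a);
  antipr : forall a (x : hcarrier 1%g),
    tmult (tmap idfun (icast hcarrier (invgK a) \o antip a^-1%g)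
      (Delta hcoalg a a^-1%g (icast hcarrier (esym (mulgV a)) x))) =
    (eps hcoalg x : k) *: (1 : hcarrier a)
}.

Definition hcast (H : hopf_pi_coalgebra) a b (e : a = b) : H a -> H b :=
  icast (fun c => H c) e.

Definition hDelta (H : hopf_pi_coalgebra) a b :
  H (a * b)%g -> tens (H a) (H b) := Delta (hcoalg H) a b.
Definition heps (H : hopf_pi_coalgebra) : H 1%g -> k := eps (hcoalg H).

(* S_{a^-1} with its codomain H_{(a^-1)^-1} identified with H_a. *)
Definition antipV (H : hopf_pi_coalgebra) a : H a^-1%g -> H a :=
  hcast (invgK a) \o antip H a^-1%g.

Record crossed_hopf_pi_coalgebra := CrossedHopfPiCoalgebra {
  crossed_hopf :> hopf_pi_coalgebra;
  phi : forall b a, {linear crossed_hopf a -> crossed_hopf (lconj b a)};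
  phi_bij : forall b a, bijective (phi b a);
  phi_hom : forall b a, GRing.monoid_morphism (phi b a);
  phi_Delta : forall b a c (x : crossed_hopf (a * c)%g),
    tmap (phi b a) (phi b c) (hDelta x) =
    hDelta (hcast (lconjM b a c) (phi b (a * c)%g x));
  phi_eps : forall b (x : crossed_hopf 1%g),
    heps (hcast (lconj1 b) (phi b 1%g x)) = heps x;
  phi_comp : forall b c a (x : crossed_hopf a),
    phi (b * c)%g a x =
    hcast (lconj_comp b c a) (phi b (lconj c a) (phi c a x))
}.

(* The map phi_{b^-1} : H_{b a b^-1} -> H_a. *)
Definition phiV (H : crossed_hopf_pi_coalgebra) b a : H (lconj b a) -> H a :=
  hcast (lconjK b a) \o phi H b^-1%g (lconj b a).

Record quasitriangular_hopf_pi_coalgebra := QuasitriangularHopfPiCoalgebra {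
  quasi_crossed :> crossed_hopf_pi_coalgebra;
  Rmx : forall a b, tens (quasi_crossed a) (quasi_crossed b);
  Rmx_inv : forall a b, invertible (Rmx a b);
  Rmx_Delta : forall a b (x : quasi_crossed (a * b)%g),
    Rmx a b * hDelta x =
    tflip (tmap (@phiV quasi_crossed a b) idfun
      (hDelta (hcast (esym (lconjMr a b)) x))) * Rmx a b;
  Rmx_Deltar : forall a b c,
    tmap idfun (@hDelta quasi_crossed b c) (Rmx a (b * c)%g) =
    leg13 (quasi_crossed b) (Rmx a c) * leg12 (quasi_crossed c) (Rmx a b);
  Rmx_Deltal : forall a b c,
    tassoc (tmap (@hDelta quasi_crossed a b) idfun (Rmx (a * b)%g c)) =
    leg13 (quasi_crossed b)
      (tmap idfun (@phiV quasi_crossed b c) (Rmx a (lconj b c))) *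
    leg23 (quasi_crossed a) (Rmx b c);
  Rmx_phi : forall b a c,
    tmap (phi quasi_crossed b a) (phi quasi_crossed b c) (Rmx a c) =
    Rmx (lconj b a) (lconj b c)
}.

Definition drinfeld (H : quasitriangular_hopf_pi_coalgebra) a : H a :=
  tmult (tmap (@antipV H a \o hcast (lconjV a) \o phi H a a^-1%g) idfun
    (tflip (Rmx H a a^-1%g))).

Record ribbon_hopf_pi_coalgebra := RibbonHopfPiCoalgebra {
  ribbon_quasi :> quasitriangular_hopf_pi_coalgebra;
  theta : forall a, ribbon_quasi a;
  theta_inv : forall a, invertible (theta a);
  theta_phi : forall a (x : ribbon_quasi a),
    hcast (lconj_id a) (phi ribbon_quasi a a x) =
    pzinv (theta a) * x * theta a;
  theta_antip : forall a, antip ribbon_quasi a (theta a) = theta a^-1%g;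
  phi_theta : forall b a, phi ribbon_quasi b a (theta a) = theta (lconj b a);
  theta_Delta : forall a b,
    hDelta (theta (a * b)%g) =
    (theta a ⊗ theta b) *
    tflip (tmap (@phiV ribbon_quasi a b) idfun
      (Rmx ribbon_quasi (lconj a b) a)) *
    Rmx ribbon_quasi a b
}.

Definition pi_grouplike (H : hopf_pi_coalgebra) (g : forall a, H a) : Prop :=
  (forall a b, hDelta (g (a * b)%g) = g a ⊗ g b) /\ heps (g 1%g) = 1.

Definition ribbon_G (H : ribbon_hopf_pi_coalgebra) a : H a :=
  theta H a * drinfeld H a.

End HopfPiCoalgebras.

(* Main.v *)
(* Write R_{a,b} = Σ s ⊗ t and u_a = Σ S(φ_a(t)) s with R_{a,a^-1} = Σ s ⊗ t.
   The intertwining property of R gives S²(φ_a(x)) u_a = u_a x. Expanding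
   Δ_{a,b}(u_ab) by the two hexagon axioms, and moving u_a and u_b to the right
   with that identity, yields
     Δ_{a,b}(u_ab) = R_{a,b}^-1 Q^-1 (u_a ⊗ u_b)
   where Q is the flip of (φ_{a^-1} ⊗ id)(R_{aba^-1,a}). The factor Q R_{a,b} is
   the one occurring in Δ_{a,b}(θ_ab), so G = θ u is grouplike, and the antipode
   axiom then says that S(G_{a^-1}) is the inverse of G_a; in particular u_a is
   invertible. The remaining claims follow from this and from
   φ_a(x) = θ_a^-1 x θ_a. *)

Require Import Defs.
From HB Require Import structures.
From mathcomp Require Import all_boot all_algebra.
Import GRing.Theory.
Local Open Scope ring_scope.

Set Implicit Arguments.
Unset Strict Implicit.
Unset Printing Implicit Defensive.

(** The obstacle in Δ_{a,b}(u_ab) is to collect [u_b]. Once [u_a] has been formed, the second tensor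
    factor reads S(φ(t')) p' s2, where s2 is a leg of Δ_{a,b}(s') and p' comes from another copy of
    R; p' separates the two legs that should make up [u_b]. [Rmx_intertwines_antipode] exchanges
    Δ_{a,b}(s') for Δ_{b,a'}(s') with a' = b^-1 a b, and this brings the legs together. The factors
    left in front are (S² ⊗ S)(R) and a flipped analogue. They are recognised as inverses of R by
    using R^-1 = (S ⊗ φ)(R) twice, which rests on the partial counits of R being 1. The second
    difficulty is the grading: degrees are often equal without being convertible. The structure maps
    are therefore used with a freely chosen target degree, and each law carries its degree equations
    as hypotheses. *)

(* The tensor comes before the function so that its type determines those of
   the bound variables. *)
Definition sw (k : fieldType) (V W U : lmodType k) (t : tens V W)
  (F : V -> W -> U) : U := tlift F t.

Notation "\sw_ ( x , y <- t ) E" := (sw t (fun x y => E))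
  (at level 41, x name, y name, t at level 99, E at level 41,
   format "\sw_ ( x ,  y  <-  t )  E") : ring_scope.

(** * Calculus of Sweedler-style sums over tensors *)

Section Multilinear.
Variable k : fieldType.
Implicit Types U V W X Y : lmodType k.

(** Kept unbundled, so that linearity of a lambda term is proved by recursion on its syntax, with no
    structure to build. *)
Definition lin U V (f : U -> V) : Prop :=
  forall c x y, f (c *: x + y) = c *: f x + f y.

Definition bil U V W (f : U -> V -> W) : Prop :=
  (forall y, lin (f^~ y)) /\ (forall x, lin (f x)).

Lemma bilP U V W (f : U -> V -> W) : bil f -> bilinear_for *:%R *:%R f.
Proof. by case=> fl fr; split=> [v c x y|u c x y]; [apply: fl|apply: fr]. Qed.

Lemma linD U V (f : U -> V) x y : lin f -> f (x + y) = f x + f y.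
Proof. by move=> fL; have := fL 1 x y; rewrite !scale1r. Qed.

Lemma lin0 U V (f : U -> V) : lin f -> f 0 = 0.
Proof. by move=> fL; apply: (addrI (f 0)); rewrite -(linD _ _ fL) !addr0. Qed.

Lemma linZ U V (f : U -> V) c x : lin f -> f (c *: x) = c *: f x.
Proof. by move=> fL; have := fL c x 0; rewrite !addr0 lin0 // addr0. Qed.

Lemma lin_linear U V (f : {linear U -> V}) : lin f.
Proof. by move=> c x y; rewrite linearP. Qed.

Lemma lin_id U : lin (fun x : U => x).
Proof. by []. Qed.

Lemma lin_zero U V : lin (fun _ : U => 0 : V).
Proof. by move=> c x y; rewrite scaler0 addr0. Qed.

Lemma lin_comp U V W (g : V -> W) (f : U -> V) :
  lin g -> lin f -> lin (fun x => g (f x)).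
Proof. by move=> gL fL c x y; rewrite fL gL. Qed.

Lemma lin_mull U (A : pzAlgType k) (f : U -> A) (b : A) :
  lin f -> lin (fun x => f x * b).
Proof. by move=> fL c x y; rewrite fL mulrDl pzscalerAl. Qed.

Lemma lin_mulr U (A : pzAlgType k) (f : U -> A) (b : A) :
  lin f -> lin (fun x => b * f x).
Proof. by move=> fL c x y; rewrite fL mulrDr pzscalerAr. Qed.

Lemma lin_tpurel U V W (f : U -> V) (w : W) : lin f -> lin (fun x => f x ⊗ w).
Proof. by move=> fL c x y; rewrite fL tpureDl tpureZl. Qed.

Lemma lin_tpurer U V W (f : U -> W) (v : V) : lin f -> lin (fun x => v ⊗ f x).
Proof. by move=> fL c x y; rewrite fL tpureDr tpureZr. Qed.

Lemma lin_scale U V (f : U -> V) c : lin f -> lin (fun x => c *: f x).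
Proof. by move=> fL d x y; rewrite fL scalerDr !scalerA mulrC. Qed.

Lemma lin_scalel U V (f : U -> k^o) (v : V) :
  lin f -> lin (fun x => (f x : k) *: v).
Proof. by move=> fL c x y; rewrite fL scalerDl -scalerA. Qed.

Lemma lin_sw U V W X (F : U -> V -> W -> X) (t : tens V W) :
  (forall v w, lin (fun x => F x v w)) ->
  lin (fun x => \sw_(v, w <- t) F x v w).
Proof.
move=> FL c x y; rewrite /sw /tlift scaler_sumr -big_split.
by apply: eq_bigr => p _ /=; rewrite FL.
Qed.

Lemma lin_swl U V W X (F : V -> W -> X) (f : U -> tens V W) :
  bil F -> lin f -> lin (fun x => sw (f x) F).
Proof. by move=> /bilP/tlift_linear FL fL c x y; rewrite fL /sw FL. Qed.

Lemma swE V W X (F : V -> W -> X) v w : bil F -> sw (v ⊗ w) F = F v w.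
Proof. by move=> /bilP/tliftE <-. Qed.

Lemma sw_ext V W X (F F' : V -> W -> X) t :
  (forall v w, F v w = F' v w) -> sw t F = sw t F'.
Proof. by move=> FF'; apply: eq_bigr. Qed.

Lemma sw_tpure V W (t : tens V W) : sw t (@tpure k V W) = t.
Proof. by rewrite [RHS]tensE. Qed.

Lemma lin_sum U V (I : Type) (f : U -> V) (s : seq I) (g : I -> U) :
  lin f -> f (\sum_(i <- s) g i) = \sum_(i <- s) f (g i).
Proof.
move=> fL; elim: s => [|i s IHs]; first by rewrite !big_nil lin0.
by rewrite !big_cons linD // IHs.
Qed.

Lemma sw_lin V W X Y (L : X -> Y) (F : V -> W -> X) t :
  lin L -> L (\sw_(v, w <- t) F v w) = \sw_(v, w <- t) L (F v w).
Proof. exact: lin_sum. Qed.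

Lemma sw_mull V W (A : pzAlgType k) (F : V -> W -> A) t b :
  (\sw_(v, w <- t) F v w) * b = \sw_(v, w <- t) F v w * b.
Proof. exact: mulr_suml. Qed.

Lemma sw_mulr V W (A : pzAlgType k) (F : V -> W -> A) t b :
  b * (\sw_(v, w <- t) F v w) = \sw_(v, w <- t) b * F v w.
Proof. exact: mulr_sumr. Qed.

Lemma sw_exchange U V W X Y (F : U -> V -> W -> X -> Y) t t' :
  \sw_(u, v <- t) \sw_(w, x <- t') F u v w x =
  \sw_(w, x <- t') \sw_(u, v <- t) F u v w x.
Proof. exact: exchange_big. Qed.

Lemma sw_sw U V W X Y (F : W -> X -> Y) (f : U -> V -> tens W X) t :
  bil F -> sw (sw t f) F = \sw_(u, v <- t) sw (f u v) F.
Proof. by move=> FB; apply: lin_sum; apply: lin_swl. Qed.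

Lemma sw_tmap V W V' W' X (f : V -> V') (g : W -> W') (F : V' -> W' -> X) t :
  lin f -> lin g -> bil F ->
  sw (tmap f g t) F = \sw_(v, w <- t) F (f v) (g w).
Proof.
by move=> fL gL FB; rewrite sw_sw //; apply: sw_ext => v w; rewrite swE.
Qed.

Lemma sw_tflip V W X (F : W -> V -> X) (t : tens V W) :
  bil F -> sw (tflip t) F = \sw_(v, w <- t) F w v.
Proof. by move=> FB; rewrite sw_sw //; apply: sw_ext => v w; rewrite swE. Qed.

Definition tril U V W X (F : U -> V -> W -> X) : Prop :=
  [/\ forall v w, lin (fun u => F u v w), forall u w, lin (fun v => F u v w) &
      forall u v, lin (fun w => F u v w)].

Lemma sw_tassoc U V W X (F : U -> V -> W -> X) t : tril F ->
  \sw_(u, q <- tassoc t) \sw_(v, w <- q) F u v w =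
  \sw_(p, w <- t) \sw_(u, v <- p) F u v w.
Proof.
case=> FL1 FL2 FL3.
have FB2 u : bil (F u) by split=> ?; [apply: FL2 | apply: FL3].
have FB : bil (fun u q => \sw_(v, w <- q) F u v w).
  split=> [q|u]; first by apply: lin_sw => v w; apply: FL1.
  by apply: lin_swl => //; apply: lin_id.
rewrite sw_sw //; apply: sw_ext => p w.
have tL : lin (fun v : V => v ⊗ w) by apply: lin_tpurel; apply: lin_id.
by rewrite sw_tmap //; apply: sw_ext => u v; rewrite swE.
Qed.

Lemma sw_mul (A B : pzAlgType k) X (F : A -> B -> X) (t t' : tens A B) :
  bil F ->
  sw (t * t') F =
  \sw_(a, b <- t) \sw_(a', b' <- t') F (a * a') (b * b').
Proof.
move=> FB; rewrite -[t in LHS]sw_tpure sw_mull sw_sw //; apply: sw_ext => a b.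
rewrite -[t' in LHS]sw_tpure sw_mulr sw_sw //; apply: sw_ext => a' b'.
by rewrite tpureM swE.
Qed.

Lemma tpure_one (A B : pzAlgType k) : (1 : A) ⊗ (1 : B) = 1.
Proof. by []. Qed.

(** Serves to show that the counit of [R] in either leg, and the counit of [G], are 1. *)
Lemma idem_invertible (A : pzRingType) (x y : A) :
  x * x = x -> x * y = 1 -> x = 1.
Proof. by move=> xx xy; rewrite -[LHS]mulr1 -xy mulrA xx. Qed.

End Multilinear.

(* Hook for the linear operators that are introduced later. *)
Ltac lin_op := fail.

(** In a sum the variable may occur in the summand ([lin_sw]) or in the tensor summed over
    ([lin_swl]), but not in both. *)
Ltac mlin :=
  lazymatch goal with
  | |- bil _ => split=> ? /=; mlin
  | |- tril _ => split=> ? ? /=; mlin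
  | |- lin (fun x => x) => apply: lin_id
  | |- lin _ =>
    first
      [ apply: lin_sw; intros ? ?; cbv beta; mlin
      | apply: lin_swl; [mlin | mlin]
      | apply: lin_mull; mlin
      | apply: lin_mulr; mlin
      | apply: lin_tpurel; mlin
      | apply: lin_tpurer; mlin
      | apply: lin_scale; mlin
      | apply: lin_scalel; mlin
      | lin_op; mlin
      | apply: (lin_comp (@lin_linear _ _ _ _)); mlin
      | match goal with
        | h : bil _ |- _ => apply: (lin_comp (proj1 h _)); mlin
        | h : bil _ |- _ => apply: (lin_comp (proj2 h _)); mlin
        | h : tril _ |- _ => case: h => h ? ?; apply: (lin_comp (h _ _)); mlin
        | h : tril _ |- _ => case: h => ? h ?; apply: (lin_comp (h _ _)); mlin
        | h : tril _ |- _ => case: h => ? ? h; apply: (lin_comp (h _ _)); mlin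
        | h : lin _ |- _ => apply: (lin_comp h); mlin
        | h : (forall _, lin _) |- _ => apply: (lin_comp (h _)); mlin
        | h : (forall _ _, lin _) |- _ => apply: (lin_comp (h _ _)); mlin
        end ]
  end.

(* Normalizes group words. *)
Ltac gp := rewrite /lconj ?(invgM, invgK, invg1, mulgA, mulg1, mul1g)%g;
  rewrite ?(mulgK, mulgVK, mulgV, mulVg, mulg1, mul1g)%g.

(** * Structure maps with free degrees *)

Section Hopf.
Variables (k : fieldType) (pi : groupType) (H : hopf_pi_coalgebra k pi).
Implicit Types (a b c d : pi).

(* Transport along an equality of indices, made total so that no proof
   occurs in terms: it is zero when the indices differ. *)
Definition ct a b (x : H a) : H b :=
  if eqVneq a b is EqNotNeq e then hcast e x else 0.
Arguments ct {a} b x.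

Lemma ctE a b (e : a = b) x : ct b x = hcast e x.
Proof.
rewrite /ct; case: eqVneq => [e'|/eqP//].
by rewrite (eq_irrelevance e e').
Qed.

Lemma ct_id a (x : H a) : ct a x = x.
Proof. by rewrite (ctE erefl). Qed.

Lemma icastE a b (e : a = b) x :
  icast (fun c => hcarrier H c : lmodType k) e x = ct b x.
Proof. by case: _ / e; rewrite ct_id. Qed.

Lemma icastAE a b (e : a = b) (x : H a) : icast (hcarrier H) e x = ct b x.
Proof. by case: _ / e; rewrite ct_id. Qed.

Lemma ct_lin a b : lin (@ct a b).
Proof.
by rewrite /ct; case: eqVneq => [e|_]; [case: _ / e | apply: lin_zero].
Qed.

Lemma lin_ct (U : lmodType k) a b (f : U -> H a) :
  lin f -> lin (fun x => ct b (f x)).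
Proof. exact/lin_comp/ct_lin. Qed.

(* The antipode, coproduct and counit (and below, with [cP], the crossing) with
   freely chosen indices; they are meaningful only when the indices match. *)
Definition cS a b (x : H a) : H b := ct b (antip H a x).
Definition cD a b c (x : H c) : tens (H a) (H b) := hDelta (ct (a * b)%g x).
Definition cep a (x : H a) : k^o := eps (hcoalg H) (ct 1%g x).
Arguments cS {a} b x.
Arguments cD a b {c} x.

Lemma lin_cS (U : lmodType k) a b (f : U -> H a) :
  lin f -> lin (fun x => cS b (f x)).
Proof. by move=> fL; apply: lin_ct; apply: lin_comp fL; apply: lin_linear. Qed.

Lemma lin_cD (U : lmodType k) a b c (f : U -> H c) :
  lin f -> lin (fun x => cD a b (f x)).
Proof.
by move=> fL; apply: (@lin_comp _ _ _ _ (@hDelta _ _ H a b));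
  [apply: lin_linear | apply: lin_ct].
Qed.

Lemma lin_cep (U : lmodType k) a (f : U -> H a) :
  lin f -> lin (fun x => cep (f x)).
Proof.
by move=> fL; apply: (@lin_comp _ _ _ _ (eps (hcoalg H)));
  [apply: lin_linear | apply: lin_ct].
Qed.

End Hopf.

Arguments ct {k pi H a} b x.
Arguments cS {k pi H a} b x.
Arguments cD {k pi H} a b {c} x.

Ltac lin_op ::=
  first [apply: lin_cS | apply: lin_cD | apply: lin_cep | apply: lin_ct].

(** * Hopf axioms as sums, and the antipode as a convolution inverse *)

Section HopfAxioms.
Variables (k : fieldType) (pi : groupType) (H : hopf_pi_coalgebra k pi).
Implicit Types (a b c d : pi) (U : lmodType k).

(** Degrees are variables tied by equations, so the law applies to degrees that agree only after a
    computation in the group; the equations become side goals, mostly closed by [gp]. *)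
Lemma cD_coassoc U a b c ab bc d (F : H a -> H b -> H c -> U) (x : H d) :
  tril F -> ab = (a * b)%g -> bc = (b * c)%g -> d = (a * b * c)%g ->
  \sw_(p, z <- cD ab c x) \sw_(x', y <- cD a b p) F x' y z =
  \sw_(x', q <- cD a bc x) \sw_(y, z <- cD b c q) F x' y z.
Proof.
move=> FT eab ebc ed; subst ab bc d.
have := Delta_coassoc (hcoalg H) x; rewrite icastE => /(congr1
  (fun t => \sw_(u, q <- t) \sw_(v, w <- q) F u v w)).
rewrite sw_tassoc // !sw_tmap; [|mlin..].
rewrite {1}/cD ct_id => e.
transitivity (\sw_(p, z <- Delta (hcoalg H) (a * b)%g c x)
   \sw_(u, v <- Delta (hcoalg H) a b p) F u v z).
  by apply: sw_ext => p z; rewrite /cD ct_id.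
by rewrite e; apply: sw_ext => u q; rewrite /cD ct_id.
Qed.

Lemma cD_counitr U a b (F : H a -> U) (x : H a) : lin F -> b = 1%g ->
  \sw_(v, w <- cD a b x) (cep w : k) *: F v = F x.
Proof.
move=> FL ->; have := Delta_counitr (hcoalg H) x; rewrite icastE => e.
have idL : lin (@idfun (H a)) by exact: lin_id.
have epsL : lin (eps (hcoalg H)) by exact: lin_linear.
rewrite -{2}e /tunitr -/(sw _ _) !sw_tmap //; last mlin.
rewrite sw_lin //; apply: sw_ext => v w.
by rewrite linZ // /cep ct_id.
Qed.

Lemma cD_counitl U a b (F : H a -> U) (x : H a) : lin F -> b = 1%g ->
  \sw_(v, w <- cD b a x) (cep v : k) *: F w = F x.
Proof.
move=> FL ->; have := Delta_counitl (hcoalg H) x; rewrite icastE => e.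
have idL : lin (@idfun (H a)) by exact: lin_id.
have epsL : lin (eps (hcoalg H)) by exact: lin_linear.
rewrite -{2}e /tunitl -/(sw _ _) !sw_tmap //; last mlin.
rewrite sw_lin //; apply: sw_ext => v w.
by rewrite linZ // /cep ct_id.
Qed.

Lemma ct_ct a b c (x : H a) : a = b -> ct c (ct b x) = ct c x.
Proof. by move=> <-; rewrite ct_id. Qed.

Lemma cSl a b e (x : H e) : b = a^-1%g -> e = 1%g ->
  \sw_(v, w <- cD b a x) cS a v * w = (cep x : k) *: (1 : H a).
Proof.
move=> -> ee; subst e; have := antipl (h := H) a x.
rewrite (_ : eps _ x = cep x); last by rewrite /cep ct_id.
move=> <-; rewrite /tmult -/(sw _ _) icastAE.
rewrite (_ : _ \o _ = @cS _ _ _ _ a); last first.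
  by apply: boolp.funext => y; rewrite /= icastAE.
by rewrite sw_tmap //; mlin.
Qed.

Lemma cSr a b e (x : H e) : b = a^-1%g -> e = 1%g ->
  \sw_(v, w <- cD a b x) v * cS a w = (cep x : k) *: (1 : H a).
Proof.
move=> -> ee; subst e; have := antipr (h := H) a x.
rewrite (_ : eps _ x = cep x); last by rewrite /cep ct_id.
move=> <-; rewrite /tmult -/(sw _ _) icastAE.
rewrite (_ : _ \o _ = @cS _ _ _ _ a); last first.
  by apply: boolp.funext => y; rewrite /= icastAE.
by rewrite sw_tmap //; mlin.
Qed.

Lemma cDM a b c (x y : H c) : c = (a * b)%g ->
  cD a b (x * y) = cD a b x * cD a b y.
Proof. by move=> e; subst; rewrite /cD !ct_id; apply: (Delta_hom H a b).2. Qed.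

Lemma cD1 a b c : c = (a * b)%g -> cD a b (1 : H c) = (1 : H a) ⊗ (1 : H b).
Proof. by move=> e; subst; rewrite /cD ct_id; apply: (Delta_hom H a b).1. Qed.

Lemma cepM a (x y : H a) : a = 1%g -> cep (x * y) = (cep x : k) * (cep y : k).
Proof. by move=> e; subst; rewrite /cep !ct_id; apply: (eps_hom H).2. Qed.

Lemma cep1 a : a = 1%g -> cep (1 : H a) = 1.
Proof. by move=> e; subst; rewrite /cep !ct_id; apply: (eps_hom H).1. Qed.

(** A left and a right convolution inverse agree, by coassociativity; in the graded setting [f] and
    [h] live in degree a and [g] in degree a^-1. The scalar [l] is there for [cS_mul], where the
    second product is a multiple of the unit. *)
Lemma convolution_unique a b (A : pzAlgType k) (f : H a -> A) (g : H b -> A)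
    (h : H a -> A) (l : k) :
  lin f -> lin g -> lin h -> b = a^-1%g ->
  (forall x : H 1%g,
    \sw_(v, w <- cD a b x) f v * g w = (cep x : k) *: (1 : A)) ->
  (forall x : H 1%g,
    \sw_(v, w <- cD b a x) g v * h w = l *: ((cep x : k) *: (1 : A))) ->
  forall x, h x = l *: f x.
Proof.
move=> fL gL hL eb fg gh x.
have e : \sw_(p, z <- cD 1%g a x) \sw_(v, w <- cD a b p) f v * g w * h z =
    \sw_(v, q <- cD a 1%g x) \sw_(w, z <- cD b a q) f v * g w * h z.
  by apply: cD_coassoc; [mlin | rewrite eb; gp..].
transitivity (\sw_(p, z <- cD 1%g a x) (cep p : k) *: h z).
  by rewrite cD_counitl.
transitivity (l *: \sw_(v, q <- cD a 1%g x) (cep q : k) *: f v); last first.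
  by rewrite cD_counitr.
rewrite sw_lin; last by apply: lin_scale; apply: lin_id.
transitivity (\sw_(p, z <- cD 1%g a x) \sw_(v, w <- cD a b p) f v * g w * h z).
  by apply: sw_ext => p z; rewrite -sw_mull fg -pzscalerAl mul1r.
rewrite e; apply: sw_ext => v q.
rewrite (sw_ext (F' := fun w z => f v * (g w * h z))); last first.
  by move=> w z; rewrite mulrA.
by rewrite -sw_mulr gh -!pzscalerAr mulr1.
Qed.

Lemma cS1 a b : a = b^-1%g -> cS b (1 : H a) = 1.
Proof.
move=> eb; have := @cSl b a 1%g 1 eb erefl.
rewrite cD1; last by rewrite eb; gp.
by rewrite swE ?mulr1 ?cep1 ?scale1r //; mlin.
Qed.

(** S(y) S(x) = Σ S(y1) y2 S(x y3) = S(x y), where the first equality is [e1] and the second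
    contracts S(y1) y2. *)
Lemma cS_mul a b (x y : H a) : a = b^-1%g ->
  cS b (x * y) = cS b y * cS b x.
Proof.
move=> ea; have eb : b = a^-1%g by rewrite ea; gp.
(* For fixed z the left side, as a function of x', is a right convolution inverse of the identity up
   to the factor ε(z): multiplying out gives Σ v S(w) over the coproduct of t z. *)
have e1 (z : H 1%g) (x' : H a) :
    \sw_(y1, y2 <- cD b a z) y1 * cS b (x' * y2) = (cep z : k) *: cS b x'.
  apply: (@convolution_unique a b (H b) (@cS _ _ _ a b) id
    (fun x' => \sw_(y1, y2 <- cD b a z) y1 * cS b (x' * y2))) => //; try mlin.
  - by move=> t; rewrite cSl.
  - move=> t; transitivity (sw (cD b a t * cD b a z) (fun v w => v * cS b w)).
      rewrite sw_mul; last mlin.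
      apply: sw_ext => v w; rewrite sw_mulr; apply: sw_ext => y1 y2.
      by rewrite mulrA.
    rewrite -cDM; last by rewrite ea; gp.
    by rewrite cSr // cepM // mulrC scalerA.
symmetry; transitivity
    (\sw_(v, q <- cD a 1%g y) (cep q : k) *: (cS b v * cS b x)).
  by rewrite (@cD_counitr _ _ _ (fun v => cS b v * cS b x)) //; mlin.
transitivity (\sw_(v, q <- cD a 1%g y) \sw_(w, z <- cD b a q)
    cS b v * w * cS b (x * z)).
  apply: sw_ext => v q; rewrite pzscalerAr -e1 sw_mulr.
  by apply: sw_ext => w z; rewrite mulrA.
rewrite -(@cD_coassoc _ _ _ _ 1%g); [|mlin|rewrite ?ea; gp..] => //.
transitivity (\sw_(p, z <- cD 1%g a y) (cep p : k) *: cS b (x * z)).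
  by apply: sw_ext => p z; rewrite -sw_mull cSl // -pzscalerAl mul1r.
by rewrite (@cD_counitl _ _ _ (fun z => cS b (x * z))) //; mlin.
Qed.

Lemma cep_cS a b (x : H a) : a = 1%g -> b = 1%g -> cep (cS b x) = cep x.
Proof.
move=> ea eb; subst a b.
have e1 : 1%g = (1 : pi)^-1%g by gp.
transitivity (\sw_(v, w <- cD 1%g 1%g x) cep (cS 1%g v * w)).
  rewrite -(@cD_counitr _ 1%g 1%g (fun v => cep (cS 1%g v))) //; last mlin.
  by apply: sw_ext => v w; rewrite cepM // mulrC.
have epsL : lin (@cep _ _ H 1%g) by apply: lin_cep; apply: lin_id.
rewrite -(sw_lin (L := @cep _ _ H 1%g)) // cSl // linZ // cep1 //.
exact: mulr1.
Qed.

(** Both sides are convolution inverses of Δ_{a,b}: the left side because Δ is multiplicative, the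
    right side by contracting first the inner pair of legs, then the outer one. *)
Lemma cD_cS a b c a' b' d (y : H d) :
  c = (a * b)%g -> d = c^-1%g -> a' = a^-1%g -> b' = b^-1%g ->
  cD a b (cS c y) = \sw_(y1, y2 <- cD b' a' y) cS a y2 ⊗ cS b y1.
Proof.
move=> ec ed ea eb; 
pose f (y : H d) := cD a b (cS c y).
pose h (y : H d) := \sw_(y1, y2 <- cD b' a' y) cS a y2 ⊗ cS b y1.
suff hf : forall y, h y = 1 *: f y by rewrite -[RHS]/(h y) hf scale1r.
apply: (@convolution_unique d c (tens (H a) (H b)) f (@cD _ _ H a b c) h 1);
  rewrite /f /h.
- mlin.
- by apply: lin_cD; apply: lin_id.
- mlin.
- by rewrite ed; gp.
- move=> x.
  have cDL : lin (@cD _ _ H a b c) by apply: lin_cD; apply: lin_id.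
  transitivity (cD a b (\sw_(v, w <- cD d c x) cS c v * w)).
    by rewrite sw_lin //; apply: sw_ext => v w; rewrite cDM.
  by rewrite cSl // linZ // cD1.
move=> x; rewrite scale1r.
transitivity (\sw_(p, w <- cD c d x) \sw_(v1, v2 <- cD a b p)
   \sw_(y1, y2 <- cD b' a' w) (v1 * cS a y2) ⊗ (v2 * cS b y1)).
  apply: sw_ext => v w; rewrite -[cD a b v in LHS]sw_tpure sw_mull.
  apply: sw_ext => v1 v2; rewrite sw_mulr; apply: sw_ext => y1 y2.
  by rewrite tpureM.
rewrite (@cD_coassoc _ a b d c a' 1%g (fun v1 v2 w => 
  \sw_(y1, y2 <- cD b' a' w) (v1 * cS a y2) ⊗ (v2 * cS b y1))); last first.
- by rewrite ed ec; gp.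
- by rewrite ed ec ea; gp.
- by rewrite ec.
- by mlin.
transitivity (\sw_(v, w <- cD a a' x) (v * cS a w) ⊗ (1 : H b)).
  apply: sw_ext => v q.
  rewrite -(@cD_coassoc _ b b' a' 1%g d a'
    (fun v2 y1 y2 => (v * cS a y2) ⊗ (v2 * cS b y1))); last first.
  - by rewrite ea eb; gp.
  - by rewrite ea ed ec eb; gp.
  - by rewrite eb; gp.
  - by mlin.
  transitivity (\sw_(p, y2 <- cD 1%g a' q)
      (cep p : k) *: ((v * cS a y2) ⊗ (1 : H b))).
    apply: sw_ext => p y2; rewrite -tpureZr -(cSr p eb erefl).
    by rewrite sw_lin //; mlin.
  by rewrite (@cD_counitl _ _ _ (fun y2 => (v * cS a y2) ⊗ (1 : H b))) //; mlin.
by rewrite -(sw_lin (L := fun t => t ⊗ (1 : H b))) ?cSr // ?tpureZl //; mlin.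
Qed.
End HopfAxioms.

(** * The crossing and its compatibility with the other structure maps *)

Section Crossing.
Variables (k : fieldType) (pi : groupType) (H : crossed_hopf_pi_coalgebra k pi).
Implicit Types (a b c d g h : pi) (U : lmodType k).

Definition cP g a b (x : H a) : H b := ct b (phi H g a x).
Arguments cP g {a} b x.

Lemma lin_cP U g a b (f : U -> H a) : lin f -> lin (fun x => cP g b (f x)).
Proof. by move=> fL; apply: lin_ct; apply: lin_comp fL; apply: lin_linear. Qed.

Lemma cPM g a b (x y : H a) : b = lconj g a ->
  cP g b (x * y) = cP g b x * cP g b y.
Proof. by move=> e; subst b; rewrite /cP !ct_id; apply: (phi_hom H g a).2. Qed.

Lemma cP1 g a b : b = lconj g a -> cP g b (1 : H a) = 1.
Proof. by move=> e; subst b; rewrite /cP !ct_id; apply: (phi_hom H g a).1. Qed.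

Lemma cP_comp g h gh a b c (x : H a) : b = lconj h a -> gh = (g * h)%g ->
  cP g c (cP h b x) = cP gh c x.
Proof.
move=> eb egh; subst b gh; rewrite /cP ct_id phi_comp -ctE.
by rewrite ct_ct // lconj_comp.
Qed.

(** φ_1 is idempotent by [phi_comp] and injective by [phi_bij]. *)
Lemma cP_id a (x : H a) : cP 1%g a x = x.
Proof.
have e1 : a = lconj 1%g a by gp.
suff: cP 1%g a (cP 1%g a x) = cP 1%g a x.
  have inj : injective (@cP 1%g a a).
    have /bij_inj phi_inj := phi_bij H 1%g a.
    move=> y z /(congr1 (ct (lconj 1%g a))).
    by rewrite /cP !ct_ct // !ct_id => /phi_inj.
  exact: inj.
by rewrite (cP_comp (gh := 1%g)) //; gp.
Qed.

Lemma cD_cP g a b c a' b' c' (x : H c) :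
  c = (a * b)%g -> a' = lconj g a -> b' = lconj g b -> c' = lconj g c ->
  cD a' b' (cP g c' x) = tmap (cP g a') (cP g b') (cD a b x).
Proof.
move=> ec ea eb ec'; subst c a' b' c'.
rewrite /cD {1}/cP !ct_id (ctE (lconjM g a b)) -phi_Delta.
by congr tmap; apply: boolp.funext => y; rewrite /cP ct_id.
Qed.

Lemma cep_cP g a b (x : H a) : a = 1%g -> b = lconj g a ->
  cep (cP g b x) = cep x.
Proof.
move=> ea eb; subst a; rewrite /cep /cP ct_id ct_ct // (ctE (lconj1 g)).
by have e := phi_eps g x; exact e.
Qed.

End Crossing.
Arguments cP {k pi H} g {a} b x.
Ltac lin_op ::=
  first [apply: lin_cS | apply: lin_cD | apply: lin_cP | apply: lin_cep
        | apply: lin_ct].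

Section CrossingAntipode.
Variables (k : fieldType) (pi : groupType) (H : crossed_hopf_pi_coalgebra k pi).
Implicit Types (a b c d g h : pi) (U : lmodType k).

(** Both composites are convolution inverses of φ_g, one from the left and one from the right. *)
Lemma cS_cP g a b a' b' (x : H a) :
  b = a^-1%g -> a' = lconj g a -> b' = lconj g b ->
  cS b' (cP g a' x) = cP g b' (cS b x).
Proof.
move=> eb ea' eb'.
pose f (x : H a) := cP g b' (cS b x); pose h (x : H a) := cS b' (cP g a' x).
suff hf y : h y = 1 *: f y by rewrite -[LHS]/(h x) hf scale1r.
apply: (@convolution_unique _ _ H a b (H b') f (@cP _ _ H g b b') h 1).
- by rewrite /f; mlin.
- by apply: lin_cP; apply: lin_id.
- by rewrite /h; mlin.
- by [].
- move=> t; transitivity (cP g b' (\sw_(v, w <- cD a b t) cS b v * w)).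
    rewrite sw_lin; last by apply: lin_cP; apply: lin_id.
    by apply: sw_ext => v w; rewrite cPM.
  rewrite cSl // ?eb; last by gp.
  rewrite linZ ?cP1 -?eb //; apply: lin_cP; apply: lin_id.
- move=> t.
  transitivity (sw (tmap (cP g b') (cP g a') (cD b a t))
      (fun v w => v * cS b' w)).
    by rewrite sw_tmap //; mlin.
  rewrite -(@cD_cP _ _ _ g b a 1%g b' a' 1%g t) //; [|by rewrite eb; gp|by gp].
  rewrite cSr //; last by rewrite eb' ea' eb; gp.
  by rewrite cep_cP ?scale1r //; gp.
Qed.

End CrossingAntipode.

(** * Quasitriangular axioms and Drinfeld elements as sums *)

Section QuasitriangularAxioms.
Variables (k : fieldType) (pi : groupType).
Variable H : quasitriangular_hopf_pi_coalgebra k pi.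
Implicit Types (a b c d g h : pi) (U : lmodType k).

Local Notation R := (Rmx H).

Lemma phiVE b a : @phiV _ _ H b a = @cP _ _ H b^-1%g (lconj b a) a.
Proof. by apply: boolp.funext => x; rewrite /phiV /cP (ctE (lconjK b a)). Qed.

Lemma Rmx_cD a b c d e (x : H c) :
  c = (a * b)%g -> d = lconj a b -> e = a^-1%g ->
  R a b * cD a b x = tflip (tmap (cP e b) (fun y => y) (cD d a x)) * R a b.
Proof.
move=> ec ed ee; subst c d e; rewrite /cD ct_id Rmx_Delta phiVE.
by rewrite -(ctE (esym (lconjMr a b))).
Qed.

Lemma Rmx_cDr U a b c d (F : H a -> H b -> H c -> U) :
  tril F -> d = (b * c)%g ->
  \sw_(s, q <- R a d) \sw_(t1, t2 <- cD b c q) F s t1 t2 =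
  \sw_(s, t <- R a c) \sw_(s', t' <- R a b) F (s * s') t' t.
Proof.
move=> FT ed; subst d.
have FB u : bil (F u) by mlin.
pose F' u q := \sw_(v, w <- q) F u v w.
have F'B : bil F' by rewrite /F'; mlin.
transitivity (sw (tmap idfun (@hDelta _ _ H b c) (R a (b * c)%g)) F').
  have DL : lin (@hDelta _ _ H b c) by apply: lin_linear.
  rewrite sw_tmap //.
  by apply: sw_ext => s q; rewrite /F' /cD ct_id.
rewrite Rmx_Deltar sw_mul // /leg13 sw_tmap; last 3 first.
- exact: lin_id.
- by mlin.
- by rewrite /F'; mlin.
apply: sw_ext => s t; rewrite /F' /leg12.
transitivity (\sw_(s', q <- tassoc (R a b ⊗ (1 : H c))) \sw_(v, w <- q)
    F (s * s') v (t * w)).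
  apply: sw_ext => s' q; rewrite sw_mul // swE; last by mlin.
  by apply: sw_ext => v w; rewrite mul1r.
rewrite sw_tassoc; last by mlin.
by rewrite swE; [apply: sw_ext => s' t'; rewrite mulr1 | mlin].
Qed.

Lemma Rmx_cDl U a b c d e g (F : H a -> H b -> H c -> U) : tril F ->
  d = (a * b)%g -> e = lconj b c -> g = b^-1%g ->
  \sw_(q, t <- R d c) \sw_(s1, s2 <- cD a b q) F s1 s2 t =
  \sw_(s, t <- R a e) \sw_(s', t' <- R b c) F s s' (cP g c t * t').
Proof.
move=> FT ed ee eg; subst d e g.
have FB u : bil (F u) by mlin.
pose F' u q := \sw_(v, w <- q) F u v w.
have F'B : bil F' by rewrite /F'; mlin.
transitivity (sw (tassoc (tmap (@hDelta _ _ H a b) idfun (R (a * b)%g c))) F').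
  have DL : lin (@hDelta _ _ H a b) by apply: lin_linear.
  rewrite /F' sw_tassoc // sw_tmap; [|by []|exact: lin_id|by mlin].
  by apply: sw_ext => q t; rewrite /cD ct_id.
rewrite Rmx_Deltal sw_mul // /leg13 sw_tmap; last 3 first.
- exact: lin_id.
- by mlin.
- by rewrite /F'; mlin.
rewrite sw_tmap; last 3 first.
- exact: lin_id.
- by rewrite phiVE; mlin.
- by rewrite /F'; mlin.
apply: sw_ext => s t; rewrite /F' /leg23 swE; last by mlin.
rewrite sw_mul // swE; last by mlin.
by apply: sw_ext => s' t'; rewrite mulr1 mul1r phiVE.
Qed.

Lemma Rmx_cP g a c a' c' : a' = lconj g a -> c' = lconj g c ->
  R a' c' = tmap (cP g a') (cP g c') (R a c).
Proof.
move=> ea ec; subst a' c'; rewrite -Rmx_phi.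
by congr tmap; apply: boolp.funext => y; rewrite /cP ct_id.
Qed.

Lemma sw_Rmx_cP U g a c a' c' (F : H a' -> H c' -> U) : bil F ->
  a' = lconj g a -> c' = lconj g c ->
  sw (R a' c') F = \sw_(s, t <- R a c) F (cP g a' s) (cP g c' t).
Proof.
by move=> FB ea ec; rewrite (Rmx_cP ea ec) sw_tmap //; mlin.
Qed.

Lemma drinfeldE a b : b = a^-1%g ->
  drinfeld H a = \sw_(s, t <- R a b) cS a (cP a b t) * s.
Proof.
move=> eb; subst b; rewrite /drinfeld /tmult -/(sw _ _).
rewrite (_ : (_ \o _ \o _) = fun x => cS a (cP a a^-1%g x)); last first.
  apply: boolp.funext => x.
  by rewrite /cS /cP (ctE (lconjV a)) (ctE (invgK a)).
rewrite sw_tmap; [|by mlin..].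
by rewrite sw_tflip //; mlin.
Qed.

End QuasitriangularAxioms.

(** * Moving elements past Drinfeld elements and past R *)

Section Intertwiners.
Variables (k : fieldType) (pi : groupType).
Variable H : quasitriangular_hopf_pi_coalgebra k pi.
Implicit Types (a b c d g h : pi) (U : lmodType k).
Local Notation R := (Rmx H).

Lemma cP_drinfeld g a a' : a' = lconj g a ->
  cP g a' (drinfeld H a) = drinfeld H a'.
Proof.
move=> ea; pose b' := a'^-1%g.
have eb : b' = lconj g a^-1 by rewrite /b' ea; gp.
rewrite (@drinfeldE _ _ H a _ erefl) (@drinfeldE _ _ H a' b' erefl).
rewrite (sw_Rmx_cP _ ea eb); last by mlin.
rewrite sw_lin; last by mlin.
apply: sw_ext => s t; rewrite cPM //; congr (_ * _).
rewrite -(cS_cP (a' := b')) //; last by gp.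
congr cS; rewrite !(cP_comp (gh := (g * a)%g)) //; try by gp.
by rewrite ea; gp.
Qed.

Lemma antipode_square_drinfeld a b (x : H a) : b = a^-1%g ->
  cS a (cS b (cP a a x)) * drinfeld H a = drinfeld H a * x.
Proof.
move=> eb; have ea : a = b^-1%g by rewrite eb; gp.
have ab1 : 1%g = (a * b)%g by rewrite eb; gp.
have ba1 : 1%g = (b * a)%g by rewrite eb; gp.
have aa : a = lconj a a by gp.
have bb : b = lconj a b by rewrite eb; gp.
(* [M] sends R_{a,b} to [u_a]. Applied to the two sides of the intertwining axiom at p in H_1, it
   gives Σ S(φ_a(p2)) u_a p1 = ε(p) u_a, by [e1] and [e2]. *)
pose M (s : H a) (t : H b) := cS a (cP a b t) * s.
have MB : bil M by rewrite /M; mlin.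
have uE : drinfeld H a = sw (R a b) M by rewrite (drinfeldE H eb).
have e1 (p : H 1%g) : sw (R a b * cD a b p) M =
    \sw_(x1, x2 <- cD a b p) cS a (cP a b x2) * drinfeld H a * x1.
  rewrite sw_mul // sw_exchange; apply: sw_ext => x1 x2.
  rewrite uE sw_mulr sw_mull; apply: sw_ext => s t.
  by rewrite /M cPM // cS_mul // !mulrA.
have e2 (p : H 1%g) : sw (R a b * cD a b p) M = (cep p : k) *: drinfeld H a.
  rewrite (Rmx_cD p ab1 bb erefl) sw_mul // sw_tflip; last by mlin.
  rewrite sw_tmap; [|by mlin..].
  rewrite sw_exchange uE sw_lin; last by mlin.
  apply: sw_ext => s t.
  transitivity (cS a (cP a b t) * (\sw_(v, w <- cD b a p) cS a v * w) * s).
    rewrite sw_mulr sw_mull; apply: sw_ext => v w.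
    rewrite /M cPM // cS_mul // (cP_comp (gh := 1%g)) ?cP_id ?mulrA //.
    - by rewrite eb; gp.
    - by gp.
  by rewrite cSl // -pzscalerAr mulr1 -pzscalerAl.
transitivity (\sw_(p, z <- cD 1%g a x)
    (cep p : k) *: (cS a (cS b (cP a a z)) * drinfeld H a)).
  rewrite (@cD_counitl _ _ _ _ _ _
    (fun z => cS a (cS b (cP a a z)) * drinfeld H a)) //; mlin.
(* The last leg z enters under S ∘ φ_a as S(z), next to x2; after coassociativity x2 S(z) contracts
   and u_a x1 remains. *)
transitivity (\sw_(p, z <- cD 1%g a x) \sw_(x1, x2 <- cD a b p)
    cS a (cP a b (x2 * cS b z)) * drinfeld H a * x1).
  apply: sw_ext => p z; rewrite pzscalerAr -e2 e1 sw_mulr.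
  apply: sw_ext => x1 x2; rewrite cPM // -(cS_cP (a' := a)) //.
  by rewrite cS_mul // !mulrA.
rewrite (@cD_coassoc _ _ _ _ _ _ _ _ 1%g _
  (fun x1 x2 z => cS a (cP a b (x2 * cS b z)) * drinfeld H a * x1)) //;
  last first.
- by rewrite -ab1; gp.
- by mlin.
transitivity (\sw_(x1, q <- cD a 1%g x) (cep q : k) *: (drinfeld H a * x1)).
  apply: sw_ext => x1 q.
  rewrite -(sw_lin (L := fun y => cS a (cP a b y) * drinfeld H a * x1));
    last by mlin.
  rewrite cSr // (linZ (f := fun y => cS a (cP a b y) * drinfeld H a * x1)).
    by rewrite cP1 // cS1 // mul1r.
  by mlin.
by rewrite (@cD_counitr _ _ _ _ _ _ (fun z => drinfeld H a * z)) //; mlin.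
Qed.

(** Axiom (i) for R_{b,n} under the algebra map p ⊗ q ↦ φ_b(q) ⊗ p, which undoes the flip and the
    φ_{b^-1} on one side. *)
Lemma Rmx_intertwines_tensor a b m n ai (y : H m) :
  ai = lconj b n -> m = (b * n)%g ->
  (\sw_(p, q <- R b n) cP b ai q ⊗ p) *
    (\sw_(y1, y2 <- cD b n y) cP b ai y2 ⊗ y1) =
  cD ai b y * (\sw_(p, q <- R b n) cP b ai q ⊗ p).
Proof.
move=> eai em.
pose F (p : H b) (q : H n) := cP b ai q ⊗ p.
have FB : bil F by rewrite /F; mlin.
transitivity (sw (R b n * cD b n y) F).
  rewrite sw_mul // sw_mull; apply: sw_ext => p q.
  by rewrite sw_mulr; apply: sw_ext => y1 y2; rewrite tpureM /F cPM.
rewrite (Rmx_cD y em eai erefl) sw_mul // sw_tflip; last by mlin.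
rewrite sw_tmap; [|by mlin..].
rewrite -[cD ai b y in RHS]sw_tpure sw_mull; apply: sw_ext => y1 y2.
rewrite sw_mulr; apply: sw_ext => p q.
rewrite tpureM /F cPM // (cP_comp (gh := 1%g)) ?cP_id //; last by gp.
by rewrite eai; gp.
Qed.

Lemma Rmx_intertwines_antipode_tensor a b a' n ai c (x : H c) :
  c = (a * b)%g -> ai = a^-1%g -> a' = (b^-1 * a * b)%g -> n = a'^-1%g ->
  let T := \sw_(p, q <- R b n) cP b ai q ⊗ p in
  \sw_(x1, x2 <- cD a b x) (cS ai x1 ⊗ (1 : H b)) * T * ((1 : H ai) ⊗ x2) =
  \sw_(x1, x2 <- cD b a' x)
    ((1 : H ai) ⊗ x1) * T * (cP b ai (cS n x2) ⊗ (1 : H b)).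
Proof.
move=> ec eai ea' en T.
have eain : ai = lconj b n by rewrite eai en ea'; gp.
have TE (w : H (ai * b)%g) : T * (\sw_(y1, y2 <- cD b n w) cP b ai y2 ⊗ y1) =
    cD ai b w * T.
  by apply: Rmx_intertwines_tensor => //; rewrite eai en ea'; gp.
(* [K] interpolates between the two sides. Contracting x3 S(x4) gives the left one; pulling the
   coproduct of the middle legs through [T] by [TE] and contracting S(x1) x2 gives the right one. *)
pose K (x1 : H a) (x2 : H b) (x3 : H n) (x4 : H a') : tens (H ai) (H b) :=
  (cS ai x1 ⊗ (1 : H b)) * (T * (cP b ai x3 ⊗ x2)) *
    (cP b ai (cS n x4) ⊗ (1 : H b)).
pose K' (x' : H c) (x3 : H n) (x4 : H a') :=
  \sw_(x1, x2 <- cD a b x') K x1 x2 x3 x4.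
transitivity (\sw_(x', e <- cD c 1%g x) (cep e : k) *:
  \sw_(x1, x2 <- cD a b x') (cS ai x1 ⊗ (1 : H b)) * T * ((1 : H ai) ⊗ x2)).
  rewrite (@cD_counitr _ _ _ _ _ _ (fun x' => \sw_(x1, x2 <- cD a b x')
    (cS ai x1 ⊗ (1 : H b)) * T * ((1 : H ai) ⊗ x2))) //; mlin.
transitivity (\sw_(x', e <- cD c 1%g x) \sw_(x3, x4 <- cD n a' e) K' x' x3 x4).
  apply: sw_ext => x' e; rewrite [RHS]sw_exchange sw_lin; last by mlin.
  apply: sw_ext => x1 x2.
  pose L (y : H n) : tens (H ai) (H b) :=
    (cS ai x1 ⊗ (1 : H b)) * T * ((1 : H ai) ⊗ x2) *
    (cP b ai y ⊗ (1 : H b)).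
  have LL : lin L by rewrite /L; mlin.
  transitivity (L (\sw_(x3, x4 <- cD n a' e) x3 * cS n x4)).
    rewrite cSr //; last by rewrite en; gp.
    by rewrite (linZ (f := L)) // /L cP1 // tpure_one mulr1.
  rewrite (sw_lin (L := L)) //; apply: sw_ext => x3 x4.
  by rewrite /L /K -!mulrA !tpureM cPM // !mul1r !mulr1.
rewrite -(@cD_coassoc _ _ _ _ c n a' b); last 4 first.
- by rewrite /K'; mlin.
- by rewrite ?en ?ea' ?ec ?eai; gp.
- by rewrite ?en ?ea' ?ec ?eai; gp.
- by rewrite ?en ?ea' ?ec ?eai; gp.
apply: sw_ext => y x4.
rewrite /K' (@cD_coassoc _ _ _ _ a b n c (ai * b)%g b); last 4 first.
- by rewrite /K; mlin.
- by rewrite ?en ?ea' ?ec ?eai; gp.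
- by rewrite ?en ?ea' ?ec ?eai; gp.
- by rewrite ?en ?ea' ?ec ?eai; gp.
transitivity (\sw_(x1, w <- cD a (ai * b)%g y) \sw_(x2, x3 <- cD ai b w)
    ((cS ai x1 * x2) ⊗ x3) * T * (cP b ai (cS n x4) ⊗ (1 : H b))).
  apply: sw_ext => x1 w; rewrite /K -sw_mull -sw_mulr -sw_mulr TE.
  rewrite -[cD ai b w in LHS]sw_tpure; clearbody T.
  rewrite (sw_mull _ (cD ai b w)) (sw_mulr _ (cD ai b w)).
  rewrite (sw_mull _ (cD ai b w)); apply: sw_ext => x2 x3.
  by rewrite !mulrA tpureM mul1r.
rewrite -(@cD_coassoc _ _ _ _ a ai b 1%g (ai * b)%g b); last 4 first.
- by mlin.
- by rewrite ?en ?ea' ?ec ?eai; gp.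
- by rewrite ?en ?ea' ?ec ?eai; gp.
- by rewrite ?en ?ea' ?ec ?eai; gp.
pose L (z : H ai) (t : H b) : tens (H ai) (H b) :=
  (z ⊗ t) * T * (cP b ai (cS n x4) ⊗ (1 : H b)).
transitivity (\sw_(p, x3 <- cD 1%g b y) (cep p : k) *: L (1 : H ai) x3).
  apply: sw_ext => p x3; rewrite -/(L _ _).
  rewrite -(sw_lin (L := fun z => L z x3)); last by rewrite /L; mlin.
  rewrite cSl //; last by rewrite eai; gp.
  by rewrite (linZ (f := fun z => L z x3)) //; rewrite /L; mlin.
by rewrite (@cD_counitl _ _ _ _ _ _ (L (1 : H ai))) //; rewrite /L; mlin.
Qed.

Lemma Rmx_intertwines_antipode U a b a' n ai c (x : H c)
    (F : H ai -> H b -> U) :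
  bil F ->
  c = (a * b)%g -> ai = a^-1%g -> a' = (b^-1 * a * b)%g -> n = a'^-1%g ->
  \sw_(p, q <- R b n) \sw_(x1, x2 <- cD a b x)
    F (cS ai x1 * cP b ai q) (p * x2) =
  \sw_(p, q <- R b n) \sw_(x1, x2 <- cD b a' x)
    F (cP b ai (q * cS n x2)) (x1 * p).
Proof.
move=> FB ec eai ea' en.
have := @Rmx_intertwines_antipode_tensor _ _ _ _ _ _ x ec eai ea' en.
move=> /(congr1 (fun t => sw t F)); rewrite !sw_sw // => e.
transitivity (\sw_(x1, x2 <- cD a b x) sw ((cS ai x1 ⊗ (1 : H b)) *
     (\sw_(p, q <- R b n) cP b ai q ⊗ p) * ((1 : H ai) ⊗ x2)) F).
  rewrite sw_exchange; apply: sw_ext => x1 x2.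
  rewrite sw_mulr sw_mull sw_sw //; apply: sw_ext => p q.
  by rewrite !tpureM swE // mul1r mulr1.
rewrite e [RHS]sw_exchange; apply: sw_ext => x1 x2.
rewrite sw_mulr sw_mull sw_sw //; apply: sw_ext => p q.
by rewrite !tpureM swE // mul1r mulr1 cPM // eai en ea'; gp.
Qed.

End Intertwiners.

(** * Explicit inverses of R *)

Section InverseRmx.
Variables (k : fieldType) (pi : groupType).
Variable H : quasitriangular_hopf_pi_coalgebra k pi.
Implicit Types (a b c d g h : pi) (U : lmodType k).
Local Notation R := (Rmx H).

(** The classical formula R^-1 = (S ⊗ id)(R); the crossing restores the degree of the second leg. *)
Definition Rinv a c : tens (H a) (H c) :=
  \sw_(s, t <- R a^-1%g (lconj a c)) cS a s ⊗ cP a^-1%g c t.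

(** (ε ⊗ id)(R_{1,c}) is the image of an invertible element under a multiplicative map ([FM]), and
    the hexagon for Δ_{1,1} makes it idempotent. *)
Lemma Rmx_epsl c : \sw_(s, t <- R 1%g c) (cep s : k) *: t = 1.
Proof.
set E := LHS.
have FM (x y : tens (H 1%g) (H c)) :
    (\sw_(s, t <- x) (cep s : k) *: t) * (\sw_(s, t <- y) (cep s : k) *: t) =
    \sw_(s, t <- x * y) (cep s : k) *: t.
  rewrite sw_mul; last by mlin.
  rewrite (sw_mull _ x); apply: sw_ext => s t.
  rewrite (sw_mulr _ y); apply: sw_ext => s' t'.
  by rewrite cepM // -pzscalerAl -pzscalerAr scalerA.
have [W [RW _]] := Rmx_inv H 1%g c.
apply: (@idem_invertible _ E (\sw_(s, t <- W) (cep s : k) *: t)); last first.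
  rewrite /E FM RW swE; last by mlin.
  by rewrite cep1 // scale1r.
have FT : tril (fun (s1 s2 : H 1%g) (t : H c) =>
  (cep s1 : k) *: ((cep s2 : k) *: t)) by mlin.
have e1c : c = lconj 1%g c by gp.
have e11 : 1%g = (1 * 1 : pi)%g by gp.
have e1V : 1%g = (1 : pi)^-1%g by gp.
transitivity (\sw_(s, t <- R 1%g c) \sw_(s', t' <- R 1%g c)
    (cep s : k) *: ((cep s' : k) *: (cP 1%g c t * t'))).
  rewrite /E (sw_mull _ (R 1%g c)); apply: sw_ext => s t.
  rewrite (sw_mulr _ (R 1%g c)); apply: sw_ext => s' t'.
  by rewrite cP_id -pzscalerAl -pzscalerAr.
rewrite -(Rmx_cDl FT e11 e1c e1V); apply: sw_ext => q t.
by rewrite (@cD_counitl _ _ _ _ _ _ (fun s => (cep s : k) *: t)) //; mlin.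
Qed.

Lemma Rmx_epsr a : \sw_(s, t <- R a 1%g) (cep t : k) *: s = 1.
Proof.
set E := LHS.
have FM (x y : tens (H a) (H 1%g)) :
    (\sw_(s, t <- x) (cep t : k) *: s) * (\sw_(s, t <- y) (cep t : k) *: s) =
    \sw_(s, t <- x * y) (cep t : k) *: s.
  rewrite sw_mul; last by mlin.
  rewrite (sw_mull _ x); apply: sw_ext => s t.
  rewrite (sw_mulr _ y); apply: sw_ext => s' t'.
  by rewrite cepM // -pzscalerAl -pzscalerAr scalerA.
have [W [RW _]] := Rmx_inv H a 1%g.
apply: (@idem_invertible _ E (\sw_(s, t <- W) (cep t : k) *: s)); last first.
  rewrite /E FM RW swE; last by mlin.
  by rewrite cep1 // scale1r.
have FT : tril (fun (s : H a) (t1 t2 : H 1%g) =>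
  (cep t2 : k) *: ((cep t1 : k) *: s)) by mlin.
have e11 : 1%g = (1 * 1 : pi)%g by gp.
transitivity (\sw_(s, t <- R a 1%g) \sw_(s', t' <- R a 1%g)
    (cep t : k) *: ((cep t' : k) *: (s * s'))).
  rewrite /E (sw_mull _ (R a 1%g)); apply: sw_ext => s t.
  rewrite (sw_mulr _ (R a 1%g)); apply: sw_ext => s' t'.
  by rewrite -pzscalerAl -pzscalerAr.
rewrite -(Rmx_cDr FT e11); apply: sw_ext => s q.
by rewrite (@cD_counitr _ _ _ _ _ _ (fun t => (cep t : k) *: s)) //; mlin.
Qed.

(** In the hexagon for Δ_{a^-1,a}, contract S(s1) s2: one side becomes this product, the other a
    counit of R_{1,c}. *)
Lemma Rinv_mul a c : Rinv a c * R a c = 1.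
Proof.
have FT : tril (fun (s1 : H a^-1%g) (s2 : H a) (t : H c) => (cS a s1 * s2) ⊗ t)
  by mlin.
have e1 : 1%g = (a^-1 * a)%g by gp.
transitivity (\sw_(q, t <- R 1%g c) \sw_(s1, s2 <- cD a^-1%g a q)
    (cS a s1 * s2) ⊗ t).
  rewrite (Rmx_cDl FT e1 erefl erefl) (sw_mull _ (R a^-1%g (lconj a c))).
  apply: sw_ext => s t; rewrite -[R a c in LHS]sw_tpure (sw_mulr _ (R a c)).
  by apply: sw_ext => s' t'; rewrite tpureM.
transitivity ((1 : H a) ⊗ \sw_(q, t <- R 1%g c) (cep q : k) *: t).
  rewrite (sw_lin (L := tpure (1 : H a))); last by mlin.
  apply: sw_ext => q t; rewrite -(sw_lin (L := fun y => y ⊗ t)); last by mlin.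
  by rewrite cSl // tpureZl tpureZr.
by rewrite Rmx_epsl tpure_one.
Qed.

Lemma RmxK a c : R a c * Rinv a c = 1.
Proof.
have [W [RW _]] := Rmx_inv H a c.
have -> // : Rinv a c = W.
by rewrite -[LHS]mulr1 -RW mulrA Rinv_mul mul1r.
Qed.

(** The hexagon contracted with S is [e]. Put [e] between 1 ⊗ S(z) and y ⊗ 1, with y ⊗ z running
    over [Rinv]: since S reverses products, the primed copy of R meets its inverse and cancels. *)
Lemma Rmx_antipr a b bi : bi = b^-1%g ->
  R a b = \sw_(y, z <- Rinv a bi) y ⊗ cS b z.
Proof.
move=> eb.
have FT : tril (fun (s : H a) (t1 : H bi) (t2 : H b) => s ⊗ (cS b t1 * t2)).
  by mlin.
have e1 : 1%g = (bi * b)%g by rewrite eb; gp.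
have e : \sw_(s, t <- R a b) \sw_(s', t' <- R a bi)
    (s * s') ⊗ (cS b t' * t) = 1.
  rewrite -(Rmx_cDr FT e1) -tpure_one -(Rmx_epsr a).
  rewrite (sw_lin (L := fun s => s ⊗ (1 : H b))); last by mlin.
  apply: sw_ext => s q; rewrite -(sw_lin (L := tpure s)); last by mlin.
  by rewrite cSl // tpureZl tpureZr.
symmetry.
transitivity (\sw_(y, z <- Rinv a bi) \sw_(s, t <- R a b) \sw_(s', t' <- R a bi)
    (s * s' * y) ⊗ (cS b z * cS b t' * t)).
  apply: sw_ext => y z.
  transitivity (((1 : H a) ⊗ cS b z) * 1 * (y ⊗ (1 : H b))).
    by rewrite -tpure_one !tpureM !mul1r !mulr1.
  rewrite -[in LHS]e (sw_mulr _ (R a b)) (sw_mull _ (R a b)).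
  apply: sw_ext => s t.
  rewrite (sw_mulr _ (R a bi)) (sw_mull _ (R a bi)); apply: sw_ext => s' t'.
  by rewrite !tpureM mul1r mulr1 mulrA.
rewrite sw_exchange -[RHS]sw_tpure; apply: sw_ext => s t.
rewrite sw_exchange.
transitivity (sw (R a bi * Rinv a bi) (fun y z => (s * y) ⊗ (cS b z * t))).
  rewrite sw_mul; last by mlin.
  apply: sw_ext => s' t'; apply: sw_ext => y z.
  by rewrite cS_mul ?mulrA // eb; gp.
rewrite RmxK swE; last by mlin.
by rewrite cS1 ?mul1r ?mulr1 // eb; gp.
Qed.

(** Unfold [Rinv], replace its R by [Rmx_antipr], unfold [Rinv] again; the two crossings cancel.
    This is the form in which inverses of R turn up in [cD_drinfeld]. *)
Lemma RinvE a b bi ai : bi = b^-1%g -> ai = a^-1%g ->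
  Rinv a b = \sw_(r, v <- R a bi) cS a (cS ai r) ⊗ cS b v.
Proof.
move=> eb ea; rewrite {1}/Rinv -ea.
pose d := lconj a b; pose di := d^-1%g.
rewrite -/d (@Rmx_antipr ai d di) // sw_sw; last by mlin.
rewrite /Rinv sw_sw; last by mlin.
have e1 : ai^-1%g = a by rewrite ea; gp.
have e2 : lconj ai di = bi by rewrite /di /d eb ea; gp.
rewrite e1 e2; apply: sw_ext => r v.
rewrite !swE; [|by mlin..]. 
congr (_ ⊗ _).
rewrite -(cS_cP (a' := bi)) ?(cP_comp (gh := 1%g)) ?cP_id //.
all: rewrite ?eb ?ea /di /d; gp => //.
Qed.

End InverseRmx.

(** * The coproduct of a Drinfeld element *)

Section DrinfeldCoproduct.
Variables (k : fieldType) (pi : groupType).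
Variable H : quasitriangular_hopf_pi_coalgebra k pi.
Implicit Types (a b c d g h : pi) (U : lmodType k).
Local Notation R := (Rmx H).

Lemma cD_drinfeld a b c ai bi :
  c = (a * b)%g -> ai = a^-1%g -> bi = b^-1%g ->
  cD a b (drinfeld H c) =
  (\sw_(r, v <- R a bi) cS a (cS ai r) ⊗ cS b v) *
  (\sw_(p, q <- R b ai) cS a (cP a ai q) ⊗ cS b (cS bi p)) *
  (drinfeld H a ⊗ drinfeld H b).
Proof.
move=> ec eai ebi.
(* a' = c^-1 a c and b' = c^-1 b c, so that φ_c carries the degrees a'^-1 and b'^-1 of the legs of t
   to a^-1 and b^-1; moreover c = b a'. *)
pose ci := c^-1%g.
pose a' := (b^-1 * a * b)%g; pose a'i := a'^-1%g.
pose b' := lconj ci b; pose b'i := b'^-1%g.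
have gE := (ec, eai, ebi).
have e1 : ci = (b'i * a'i)%g by rewrite /ci /b'i /a'i /b' /a' /ci !gE; gp.
have e2 : bi = lconj c b'i by rewrite /b'i /b' /ci !gE; gp.
have e3 : ai = lconj c a'i by rewrite /a'i /a' !gE; gp.
have e4 : ci = lconj c ci by rewrite /ci; gp.
have e5 : ai = lconj b a'i by rewrite /a'i /a' !gE; gp.
have e6 : bi = lconj a' b'i by rewrite /a' /b'i /b' /ci !gE; gp.
have e7 : c = (b * a')%g by rewrite /a' !gE; gp.
have e8 : a = (c * bi)%g by rewrite !gE; gp.
have e9 : b = (c * a'i)%g by rewrite /a'i /a' !gE; gp.
have e10 : a = lconj a a by gp.
have e11 : ai = lconj a ai by rewrite eai; gp.
have e12 : b = lconj b b by gp.
have e13 : bi = lconj b bi by rewrite ebi; gp.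
have e14 : a = lconj c a' by rewrite /a' !gE; gp.
have e15 : a'i = lconj bi ai by rewrite /a'i /a' !gE; gp.
have e16 : b'i = lconj a'i bi by rewrite /b'i /a'i /b' /a' /ci !gE; gp.
have eaV : a = ai^-1%g by rewrite eai; gp.
have ebV : b = bi^-1%g by rewrite ebi; gp.
have eci : ci = c^-1%g by [].
have ea' : a' = (b^-1 * a * b)%g by [].
have ea'i : a'i = a'^-1%g by [].
clearbody b'i; clearbody b'; clearbody a'i; clearbody a'; clearbody ci.
clear b' gE.
pose u := drinfeld H; rewrite -/u.
pose X (q : H a'i) (r : H a') : H a :=
  cS a (cP a ai (cP b ai (q * cS a'i r))) * u a.
transitivity (\sw_(s, t <- R c ci) \sw_(t1, t2 <- cD b'i a'i t)
    (cS a (cP c ai t2) ⊗ cS b (cP c bi t1)) * cD a b s).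
  rewrite /u (drinfeldE H eci) sw_lin; last by mlin.
  apply: sw_ext => s t; rewrite cDM //.
  rewrite (@cD_cS _ _ _ a b c ai bi ci) //.
  rewrite (@cD_cP _ _ _ c b'i a'i ci bi ai ci _ e1 e2 e3 e4).
  by rewrite sw_tmap ?(sw_mull _ (cD b'i a'i t)) //; mlin.
rewrite (Rmx_cDr (F := fun s t1 t2 =>
  (cS a (cP c ai t2) ⊗ cS b (cP c bi t1)) * cD a b s)) //; last by mlin.
transitivity (\sw_(s', t' <- R c b'i) \sw_(p', q' <- R b a'i)
    ((cS a (cP c ai q') * u a) ⊗ (cS b (cP c bi t') * p')) * cD a b s').
  rewrite sw_exchange; apply: sw_ext => s' t'.
  transitivity (\sw_(s, t <- R c a'i) \sw_(s1, s2 <- cD a b s)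
      ((cS a (cP c ai t) * s1) ⊗ (cS b (cP c bi t') * s2)) * cD a b s').
    apply: sw_ext => s t; rewrite cDM // mulrA -[cD a b s in LHS]sw_tpure.
    rewrite (sw_mulr _ (cD a b s)) (sw_mull _ (cD a b s)).
    by apply: sw_ext => s1 s2; rewrite tpureM.
  (* The hexagon in the first leg produces a copy of R_{a,a^-1}, whose legs form [u_a]. *)
  rewrite (Rmx_cDl (F := fun s1 s2 t =>
    ((cS a (cP c ai t) * s1) ⊗ (cS b (cP c bi t') * s2)) * cD a b s')
    (d := c) _ ec e5 ebi); last by mlin.
  rewrite sw_exchange; apply: sw_ext => p' q'.
  rewrite -(sw_mull _ (R a ai)); congr (_ * _).
  rewrite /u (drinfeldE H eai) (sw_mulr _ (R a ai)).
  rewrite (sw_lin (L := fun z => z ⊗ (cS b (cP c bi t') * p'))); last by mlin.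
  apply: sw_ext => p q; congr (_ ⊗ _).
  rewrite cPM // cS_mul // mulrA; congr (_ * cS a _ * _).
  by rewrite (cP_comp (gh := a)).
(* u_a s1 = S²(φ_a(s1)) u_a puts the first factor in the shape required by
   [Rmx_intertwines_antipode], which then replaces p' s2 by s1 p'. *)
transitivity (\sw_(s', t' <- R c b'i) \sw_(p', q' <- R b a'i)
    \sw_(s1, s2 <- cD b a' s')
    X q' s2 ⊗ (cS b (cP c bi t') * (s1 * p'))).
  apply: sw_ext => s' t'.
  pose F (x : H ai) (y : H b) :=
    (cS a (cP a ai x) * u a) ⊗ (cS b (cP c bi t') * y).
  have FB : bil F by rewrite /F; mlin.
  rewrite -(@Rmx_intertwines_antipode _ _ _ _ a b a' a'i ai c s' F FB) //.
  apply: sw_ext => p' q'; rewrite -[cD a b s' in LHS]sw_tpure.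
  rewrite (sw_mulr _ (cD a b s')).
  apply: sw_ext => s1 s2; rewrite tpureM /F mulrA; congr (_ ⊗ _).
  rewrite cPM // cS_mul // -!mulrA -(antipode_square_drinfeld _ eai).
  by rewrite (cS_cP (a := a) (b := ai)) // (cP_comp (gh := c)).
rewrite sw_exchange.
(* Since c = b a', the hexagon in the first leg splits R_{c,b'^-1}; its new leg now stands next to
   S(φ(t)), so [u_b] forms and is moved to the right past p'. *)
transitivity (\sw_(p', q' <- R b a'i) \sw_(r', v' <- R a' b'i)
    X q' r' ⊗ (cS b (cP c bi v') * (cS b (cS bi (cP b b p')) * u b))).
  apply: sw_ext => p' q'.
  rewrite (Rmx_cDl
    (F := fun s1 s2 t => X q' s2 ⊗ (cS b (cP c bi t) * (s1 * p')))
    (d := c) _ e7 e6 ea'i); last by rewrite /X; mlin.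
  rewrite sw_exchange; apply: sw_ext => r' v'.
  rewrite -(sw_lin (L := tpure (X q' r'))); last by mlin.
  congr (_ ⊗ _).
  rewrite antipode_square_drinfeld // /u (drinfeldE H ebi).
  rewrite (sw_mull _ (R b bi)) (sw_mulr _ (R b bi)).
  apply: sw_ext => r v; rewrite cPM // cS_mul // (cP_comp (gh := b)) //.
  by rewrite !mulrA.
(* In the claim, R_{a,b^-1} and R_{b,a^-1} are pulled back along φ_c and φ_b to the degrees reached
   above. *)
symmetry.
rewrite (@sw_Rmx_cP _ _ H _ c a' b'i a bi) //; last by mlin.
rewrite (@sw_Rmx_cP _ _ H _ b b a'i b ai) //; last by mlin.
rewrite -mulrA (sw_mull _ (R b a'i)) (sw_mulr _ (R b a'i)).
apply: sw_ext => p' q'; rewrite (sw_mull _ (R a' b'i)).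
apply: sw_ext => r' v'; rewrite !tpureM /X; congr (_ ⊗ _).
rewrite mulrA; congr (_ * _).
rewrite !(cP_comp (gh := c)) // cPM // cS_mul //.
by rewrite (cS_cP (a := a') (b := a'i)).
Qed.

End DrinfeldCoproduct.

(** * Cancelling the double braiding *)

Section DoubleBraiding.
Variables (k : fieldType) (pi : groupType).
Variable H : quasitriangular_hopf_pi_coalgebra k pi.
Implicit Types (a b c d g h : pi) (U : lmodType k).
Local Notation R := (Rmx H).

(** By [RinvE] the first factor in [cD_drinfeld] is R_{a,b}^-1. The second is the image of
    R_{b,a}^-1 under the algebra map s ⊗ t ↦ φ_a(t) ⊗ s, which by φ_a-invariance sends R_{b,a} to
    the flipped factor here. *)
Lemma double_braiding_drinfeld a b c : c = (a * b)%g ->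
  tflip (tmap (@phiV _ _ H a b) idfun (R (lconj a b) a)) * R a b *
    cD a b (drinfeld H c) = drinfeld H a ⊗ drinfeld H b.
Proof.
move=> ec; pose ai := a^-1%g; pose bi := b^-1%g.
have eai : ai = a^-1%g by [].
have ebi : bi = b^-1%g by [].
have aa : a = lconj a a by gp.
have aia : ai = lconj a ai by rewrite eai; gp.
rewrite (cD_drinfeld H ec eai ebi) -(RinvE H ebi eai) phiVE -/ai.
rewrite !mulrA -(mulrA _ (R a b)) RmxK mulr1.
set P := tflip _; set P' := sw _ _.
suff -> : P * P' = 1 by rewrite mul1r.
have -> : P = \sw_(s, t <- R b a) cP a a t ⊗ s.
  rewrite /P -[tflip _]sw_tpure sw_tflip; last by mlin.
  rewrite sw_tmap; [|by mlin..].
  rewrite (@sw_Rmx_cP _ _ H _ a b a) //; last by mlin.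
  apply: sw_ext => s t; rewrite (cP_comp (gh := 1%g)) ?cP_id //.
  by rewrite eai; gp.
transitivity (sw (R b a * Rinv H b a) (fun s t => cP a a t ⊗ s)).
  rewrite sw_mul; last by mlin.
  rewrite (sw_mull _ (R b a)); apply: sw_ext => s t.
  rewrite (RinvE H eai ebi) sw_sw; last by mlin.
  rewrite (sw_mulr _ (R b ai)); apply: sw_ext => p q.
  rewrite swE; last by mlin.
  rewrite tpureM cPM //; congr (_ ⊗ _); congr (_ * _).
  by rewrite (cS_cP (b := a)) // eai; gp.
rewrite RmxK swE; last by mlin.
by rewrite cP1.
Qed.

Lemma cep_drinfeld : cep (drinfeld H 1%g) = 1.
Proof.
have e1 : 1%g = (1 : pi)^-1%g by gp.
have e11 : (1 : pi)%g = lconj 1%g 1%g by gp.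
rewrite (drinfeldE H e1) sw_lin; last by mlin.
transitivity (cep (\sw_(s, t <- R 1%g 1%g) (cep s : k) *: t)); last first.
  by rewrite Rmx_epsl cep1.
rewrite sw_lin; last by mlin.
apply: sw_ext => s t.
rewrite cepM // cep_cS // cP_id mulrC.
by rewrite (linZ (f := @cep _ _ H 1%g)) //; mlin.
Qed.

End DoubleBraiding.

(** * The grouplike element and its consequences *)

Section Ribbon.
Variables (k : fieldType) (pi : groupType) (H : ribbon_hopf_pi_coalgebra k pi).
Implicit Types (a b c d g h : pi).

Local Notation G := (ribbon_G H).
Local Notation u := (drinfeld H).

Lemma cP_theta_conj a (x : H a) : cP a a x = pzinv (theta H a) * x * theta H a.
Proof. by rewrite -theta_phi /cP (ctE (lconj_id a)). Qed.

(** φ_a fixes [u_a] and is conjugation by θ_a. *)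
Lemma theta_drinfeldC a : theta H a * u a = u a * theta H a.
Proof.
have [tK _] := pzinvP (theta_inv H a).
have aa : a = lconj a a by gp.
have e : cP a a (u a) = u a by exact: cP_drinfeld.
by rewrite -[in LHS]e cP_theta_conj !mulrA tK mul1r.
Qed.

Lemma cD_ribbon_G a b c : c = (a * b)%g -> cD a b (G c) = G a ⊗ G b.
Proof.
move=> ec; rewrite /ribbon_G cDM //.
have -> : cD a b (theta H c) = (theta H a ⊗ theta H b) *
    (tflip (tmap (@phiV _ _ H a b) idfun (Rmx H (lconj a b) a)) * Rmx H a b).
  by subst c; rewrite /cD ct_id theta_Delta mulrA.
by rewrite -mulrA double_braiding_drinfeld // tpureM.
Qed.

(** The counit law at the grouplike G_1 makes ε(G_1) idempotent; it equals ε(θ_1), which is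
    invertible because θ_1 is. *)
Lemma cep_ribbon_G : cep (G 1%g) = 1.
Proof.
have e11 : 1%g = (1 * 1 : pi)%g by gp.
have epsT : cep (G 1%g) = cep (theta H 1%g).
  by rewrite /ribbon_G cepM // cep_drinfeld mulr1.
have [tK _] := pzinvP (theta_inv H 1%g).
have e : (cep (G 1%g) : k) * (cep (pzinv (theta H 1%g)) : k) = 1.
  by rewrite epsT -cepM // tK cep1.
apply: idem_invertible e.
have := @cD_counitl _ _ H _ 1%g 1%g (fun x => cep x) (G 1%g).
rewrite (cD_ribbon_G e11) swE; last by mlin.
by move=> e; rewrite -[RHS]e //; mlin.
Qed.

Lemma ribbon_G_antip a b : b = a^-1%g -> is_inverse (cS a (G b)) (G a).
Proof.
move=> eb; have e1 : 1%g = (b * a)%g by rewrite eb; gp.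
have e2 : 1%g = (a * b)%g by rewrite eb; gp.
split.
  have := @cSl _ _ H a b 1%g (G 1%g) eb erefl.
  by rewrite (cD_ribbon_G e1) swE ?cep_ribbon_G ?scale1r //; mlin.
have := @cSr _ _ H a b 1%g (G 1%g) eb erefl.
by rewrite (cD_ribbon_G e2) swE ?cep_ribbon_G ?scale1r //; mlin.
Qed.

End Ribbon.

Theorem lemma19 (k : fieldType) (pi : groupType)
    (H : ribbon_hopf_pi_coalgebra k pi) :
  let u := fun a : pi => drinfeld H a in
  let G := fun a : pi => ribbon_G H a in
  (* the two expressions of G agree, and the inverses of G used below exist *)
  (forall a : pi, theta H a * u a = u a * theta H a) /\
  (forall a : pi, invertible (G a)) /\
  (* (a) *)
  pi_grouplike G /\
  (* (b) *)
  (forall a b : pi, phi H b a (G a) = G (lconj b a)) /\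
  (* (c) *)
  (forall a : pi, antip H a (G a) = pzinv (G a^-1%g)) /\
  (* (d) *)
  (forall a : pi,
    pzinv (theta H a) ^+ 2 = antipV (u a^-1%g) * u a /\
    pzinv (theta H a) ^+ 2 = u a * antipV (u a^-1%g)) /\
  (* (e) *)
  (forall a : pi,
    antip H a (u a) = pzinv (G a^-1%g) * u a^-1%g * pzinv (G a^-1%g)) /\
  (* (f) *)
  (forall (a : pi) (x : H a),
    antipV (antip H a x) = G a * x * pzinv (G a)).
Proof.
move=> u G.
have tu a : theta H a * u a = u a * theta H a by exact: theta_drinfeldC.
have thK a := pzinvP (theta_inv H a).
have antipE a (x : H a) : antip H a x = cS a^-1%g x by rewrite /cS ct_id.
have antipVE a (x : H a^-1%g) : antipV x = cS a x.
  by rewrite /cS (ctE (invgK a)).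
have GV a b : b = a^-1%g -> is_inverse (G a) (cS a (G b)).
  by move=> eb; have [? ?] := @ribbon_G_antip _ _ H a b eb.
have GinvE a b : b = a^-1%g -> pzinv (G a) = cS a (G b).
  by move=> eb; apply: pzinv_unique; apply: GV.
have Ginv a : invertible (G a) by exists (cS a (G a^-1%g)); apply: GV.
have GK a := pzinvP (Ginv a).
have uE a : u a = pzinv (theta H a) * G a.
  by rewrite /G /ribbon_G mulrA (thK a).2 mul1r.
have uE' a : u a = G a * pzinv (theta H a).
  by rewrite /G /ribbon_G tu -mulrA (thK a).1 mulr1.
have cS_theta a b : b = a^-1%g -> cS b (theta H a) = theta H b.
  by move=> eb; subst b; rewrite -antipE theta_antip.
(* From G_b^-1 = S(G_a) = S(u_a) S(θ_a) = S(u_a) θ_b. Parts (d) and (e) follow from this by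
   cancelling G. *)
have cS_u a b : b = a^-1%g -> cS b (u a) = pzinv (G b) * pzinv (theta H b).
  move=> eb; have ea : a = b^-1%g by rewrite eb; gp.
  rewrite (GinvE _ _ ea) /G /ribbon_G cS_mul // cS_theta //.
  by rewrite -mulrA (thK b).1 mulr1.
do !split.
- by [].
- by [].
- move=> a b; have := @cD_ribbon_G _ _ H a b _ erefl.
  by rewrite /cD ct_id.
- by have := cep_ribbon_G H; rewrite /cep ct_id.
- move=> a b.
  have phiE x : phi H b a x = cP b (lconj b a) x by rewrite /cP ct_id.
  rewrite phiE /G /ribbon_G cPM // cP_drinfeld // -phiE.
  by rewrite phi_theta.
- by move=> a; rewrite antipE (GinvE _ a) //; gp.
- clearbody G; rewrite antipVE (cS_u _ a); last by gp.
  by rewrite -mulrA {1}uE' (mulrA _ (G a)) -uE uE' !mulrA (GK a).2 mul1r expr2.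
- clearbody G; rewrite antipVE (cS_u _ a); last by gp.
  by rewrite uE !mulrA -(mulrA _ (G a)) (GK a).1 mulr1 expr2.
- move=> a; clearbody G; rewrite antipE (cS_u a a^-1%g erefl) uE.
  by rewrite -!mulrA (GK _).1 mulr1.
(* The preimage y = θ x θ^-1 of x under φ_a turns S²(φ_a(y)) u = u y into S²(x) u = u θ x θ^-1;
   multiply by θ on the right. *)
- move=> a x; rewrite antipVE antipE.
  pose y := theta H a * x * pzinv (theta H a).
  have yE : cP a a y = x.
    rewrite cP_theta_conj /y !mulrA (thK a).2 mul1r.
    by rewrite -mulrA (thK a).2 mulr1.
  have := antipode_square_drinfeld y (erefl a^-1%g); rewrite yE -/(u a) => e.
  have {}e : cS a (cS a^-1%g x) * G a = G a * x.
    have GE : G a = u a * theta H a by rewrite -tu.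
    clearbody G u; rewrite GE mulrA e /y -!mulrA.
    by rewrite (thK a).2 mulr1.
  by clearbody G; rewrite -e -mulrA (GK a).1 mulr1.
Qed.
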